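(* Let $k$ be a unital commutative ring, $n$ a positive integer, and let $\delta,\gamma\in k$ be invertible. Then there exist isomorphisms of graded $k$-modules \[\operatorname{Tor}_{\star}^{\mathbf{Bl}_n(\delta,\gamma)}(\mathbf{1},\mathbf{1})\cong\begin{cases}k&\star=0\\0&\star>0\end{cases}\quad\text{and}\quad\operatorname{Ext}^{\star}_{\mathbf{Bl}_n(\delta,\gamma)}(\mathbf{1},\mathbf{1})\cong\begin{cases}k&\star=0\\0&\star>0.\end{cases}\]
   Context: A Temperley-Lieb $n$-diagram is a graph on $2n$ vertices $1,\dots,n$ (left column, top to bottom) and $\bar1,\dots,\bar n$ (right column, top to bottom), drawn in the rectangle they span, in which every vertex lies on exactly one edge and no two edges cross. An edge joining the two columns is propagating; one joining two vertices in the same column is non-propagating. A blob $n$-diagram is a Temperley-Lieb $n$-diagram in which edges may each be decorated with a single blob, subject to: no edge lying below the top-most propagating edge is decorated; and among any family of nested non-propagating edges only the outer-most may be decorated. The blob algebra $\mathbf{Bl}_n(\delta,\gamma)$ is the free $k$-module on blob $n$-diagrams with product of diagrams: identify the right column of $d_1$ with the left column of $d_2$ (middle column); let $\alpha$ (resp. $\beta$) be the number of closed loops lying in the middle column containing no blob (resp. at least one blob); let $d_3$ join two outer vertices iff they are joined by a path, the resulting edge carrying a blob iff some edge of the path carries a blob; then $d_1d_2=\delta^\alpha\gamma^\beta d_3$. The identity is the diagram with $n$ horizontal undecorated edges. The augmentation $\tau$ sends the identity diagram to $1$ and every other diagram to $0$; $\mathbf{1}$ denotes $k$ with the algebra acting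 via $\tau$. *)

(* Defs.v *)
From HB Require Import structures.
From mathcomp Require Import all_boot all_algebra.
Set Implicit Arguments. Unset Strict Implicit. Unset Printing Implicit Defensive.
Import GRing.Theory.
Local Open Scope ring_scope.

(* Blob n-diagrams.  Vertices: inl i = left vertex i+1, inr j = right vertex  *)
(* (j+1)bar, numbered top to bottom.  A diagram is a pair (m, b) with m the   *)
(* fixed-point-free involution giving the edges and b the blob marking        *)
(* (a vertex is marked iff its edge carries a blob).                          *)
Section Diagrams.
Variable n : nat.

Definition vtx := ('I_n + 'I_n)%type.

(* position on the boundary of the rectangle, read counterclockwise:
   left column top to bottom, then right column bottom to top *)
Definition pos (v : vtx) : nat :=
  match v with inl i => nat_of_ord i | inr j => (n + (n - j.+1))%N end.

Definition is_left (v : vtx) : bool := if v is inl _ then true else false.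

Definition propag (m : {ffun vtx -> vtx}) (v : vtx) : bool :=
  is_left v != is_left (m v).

Definition lo (m : {ffun vtx -> vtx}) v := minn (pos v) (pos (m v)).
Definition hi (m : {ffun vtx -> vtx}) v := maxn (pos v) (pos (m v)).

(* vertex v lies weakly above the propagating edge starting at left vertex i *)
Definition above (m : {ffun vtx -> vtx}) (v : vtx) (i : 'I_n) : bool :=
  match v, m (inl i) with
  | inl a, _ => (a <= i)%N
  | inr b, inr j => (b <= j)%N
  | inr _, inl _ => true
  end.

Definition is_blob_diagram (x : {ffun vtx -> vtx} * {ffun vtx -> bool}) : bool :=
  let m := x.1 in let b := x.2 in
  [&&
      [forall v, (m (m v) == v) && (m v != v)],
      (* no two edges cross *)
      [forall a, forall c,
         ~~ [&& (pos a < pos c)%N, (pos c < pos (m a))%N & (pos (m a) < pos (m c))%N]],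
      [forall v, b (m v) == b v],
      (* no decorated edge lies below the top-most propagating edge *)
      [forall v, forall i : 'I_n, (b v && propag m (inl i)) ==> above m v i]
    & (* a decorated non-propagating edge is not nested in a non-propagating edge *)
      [forall v, forall w,
         ~~ [&& b v, ~~ propag m v, ~~ propag m w,
                (lo m w < lo m v)%N & (hi m v < hi m w)%N]]].

Definition diag := {x : {ffun vtx -> vtx} * {ffun vtx -> bool} | is_blob_diagram x}.

Definition id_data : {ffun vtx -> vtx} * {ffun vtx -> bool} :=
  ([ffun v => match v with inl i => inr i | inr i => inl i end], [ffun => false]).

(* Composition: the vertices of d1 (inl) and of d2 (inr); the right column of
   d1 is glued to the left column of d2 (the middle column). *)
Definition wv := (vtx + vtx)%type.

Definition crel (d1 d2 : diag) : rel wv := fun x y =>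
  match x, y with
  | inl u, inl v => (val d1).1 u == v
  | inr u, inr v => (val d2).1 u == v
  | inl (inr j), inr (inl k) => j == k
  | inr (inl j), inl (inr k) => j == k
  | _, _ => false
  end.

Definition emb (v : vtx) : wv :=
  match v with inl i => inl (inl i) | inr j => inr (inr j) end.

Definition outer (x : wv) : bool :=
  match x with inl (inl _) => true | inr (inr _) => true | _ => false end.

Definition wblob (d1 d2 : diag) (x : wv) : bool :=
  match x with inl u => (val d1).2 u | inr u => (val d2).2 u end.

Definition composite (d1 d2 e : diag) : bool :=
  [forall u, forall w,
     ((val e).1 u == w) == ((u != w) && connect (crel d1 d2) (emb u) (emb w))]
  && [forall u, (val e).2 u ==
        [exists x, connect (crel d1 d2) (emb u) x && wblob d1 d2 x]].

Definition wcomp (d1 d2 : diag) (x : wv) : {set wv} :=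
  [set y | connect (crel d1 d2) x y].

Definition loops (d1 d2 : diag) : {set {set wv}} :=
  [set wcomp d1 d2 x | x in [pred x | [forall y, connect (crel d1 d2) x y ==> ~~ outer y]]].

Definition nloops_plain d1 d2 : nat :=
  #|[set C in loops d1 d2 | [forall y in C, ~~ wblob d1 d2 y]]|.
Definition nloops_blob d1 d2 : nat :=
  #|[set C in loops d1 d2 | [exists y in C, wblob d1 d2 y]]|.

End Diagrams.

(* Structure constants of Bl_n(delta, gamma), augmentation, and the (standard *)
(* unnormalised) bar complexes computing Tor^{Bl_n}(1,1) and Ext_{Bl_n}(1,1). *)
Section Bar.
Variables (R : comPzRingType) (n : nat) (delta gamma : R).

(* coefficient of the basis diagram e in the product d1 d2 *)
Definition mulc (d1 d2 e : diag n) : R :=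
  if composite d1 d2 e
  then delta ^+ nloops_plain d1 d2 * gamma ^+ nloops_blob d1 d2 else 0.

Definition tau (d : diag n) : R := (val d == id_data n)%:R.

(* C_q = A^{(x) q} (tensor over k), with basis the q-tuples of diagrams;
   C^q = Hom_k(A^{(x) q}, k) is identified with functions on the same basis. *)
Local Notation chain q := {ffun q.-tuple (diag n) -> R}.

(* coefficient of s in the bar differential of t = (a_0,...,a_q):
   d(a_0|...|a_q) = tau(a_0)(a_1|...|a_q)
                  + sum_{i<q} (-1)^(i+1) (a_0|...|a_i a_(i+1)|...|a_q)
                  + (-1)^(q+1) (a_0|...|a_(q-1)) tau(a_q) *)
Definition bd (q : nat) (t : (q.+1).-tuple (diag n)) (s : q.-tuple (diag n)) : R :=
  let x0 := thead t in
  tau x0 * (val s == behead t)%:R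
  + \sum_(i < q) (-1) ^+ i.+1 *
      \sum_(e : diag n) mulc (nth x0 t i) (nth x0 t i.+1) e
                          * (val s == take i t ++ e :: drop i.+2 t)%:R
  + (-1) ^+ q.+1 * tau (nth x0 t q) * (val s == take q t)%:R.

(* d : C_{q+1} -> C_q  (Tor complex  1 (x)_A Bar(A) ) *)
Definition tor_d (q : nat) (x : chain q.+1) : chain q :=
  [ffun s => \sum_(t : (q.+1).-tuple (diag n)) x t * bd t s].

(* delta : C^q -> C^{q+1}  (Ext complex  Hom_A(Bar(A), 1) ) *)
Definition ext_d (q : nat) (f : chain q) : chain q.+1 :=
  [ffun t => \sum_(s : q.-tuple (diag n)) bd t s * f s].

End Bar.

Notation chain R n q := {ffun q.-tuple (diag n) -> R%type} (only parsing).

(* Main.v *)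
(* The ideal of non-identity diagrams is the union of the right ideals J_0 (the top left vertex carries
   a blob) and J_i, 0 < i < n (an undecorated edge joins the left vertices i - 1 and i).  Each J_i is
   generated by an idempotent: the blob on the top strand, resp. the cup-cap diagram U_i divided by
   delta.  Consecutive J_i are disjoint, and the idempotent of J_j maps J_i into itself as soon as
   i + 1 < j.  Hence J_j meets the union of its predecessors in a retract of the union of the J_i with
   i + 1 < j, and by induction on j the bar complex of every partial union is contractible.  Adding
   the words that start with the identity diagram gives a contraction of the bar complex of the trivial
   module in positive degrees, and its matrix and the transposed matrix kill Tor and Ext.

   The bar complex rests on the associativity of the diagram product, which is obtained by counting
   colourings of the middle vertices that are constant along edges. *)
Require Import Defs.
From HB Require Import structures.
From mathcomp Require Import all_boot all_algebra.
From mathcomp Require Import ring zify.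
Set Implicit Arguments. Unset Strict Implicit. Unset Printing Implicit Defensive.
Import GRing.Theory.

(** * Planarity as a parity condition *)

Section Planarity.
Variable n : nat.
Notation vtx := (vtx n).

(** Crossing and nesting are inequalities between boundary positions and give no control over a path
    that wanders through the middle column. The number of vertices of a component above a given
    vertex, taken mod 2, is additive over edges and passes unchanged through the gluing, which is
    why the diagram axioms are recast as parities.

    For [i > 0] the ideal [J_i] must exclude decorated caps: [U_i] would close such a cap into a
    loop of weight [gamma] and return it without its blob, so it would not act as a scalar. The blob
    rule saves the covering, because a decorated cap that none of these ideals accounts for sits at
    the very top and falls into [J_0].

    The contraction is built on cochains, where a homotopy is a pointwise formula on words and no
    tensor product has to be formed; finiteness of the set of diagrams gives it a matrix, hence a
    version on chains. *)

Definition higher (x v : vtx) : bool :=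
  match x, v with
  | inl i, inl j => (i < j)%N
  | inr i, inr j => (i < j)%N
  | _, _ => false
  end.
(* The edge through [x] separates [v] from the top side of the rectangle. *)
Definition sep (m : vtx -> vtx) (x v : vtx) : bool := higher x v (+) higher (m x) v.

Lemma pos_inj : injective (@pos n).
Proof.
move=> [[i Hi]|[i Hi]] [[j Hj]|[j Hj]] /= e; try lia.
  by congr inl; apply: val_inj => /=; lia.
by congr inr; apply: val_inj => /=; lia.
Qed.

Lemma pos_neq (x v : vtx) : x != v -> pos x <> pos v.
Proof. by move=> /eqP h e; apply: h; apply: pos_inj. Qed.

(** The condition [above], stated for the two ends of an edge. It restricts only when [x] is on the
    left and [y] on the right, so both orders are assumed for an unoriented edge. *)
Definition below_at (x y v : vtx) : bool :=
  match x, y, v with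
  | inl i, inr _, inl a => (a <= i)%N
  | inl _, inr j, inr b => (b <= j)%N
  | _, _, _ => true
  end.

Definition crossing (a b c d : vtx) : bool :=
  [&& (pos a < pos c)%N, (pos c < pos b)%N & (pos b < pos d)%N].

Definition nested_in (v w x y : vtx) : bool :=
  [&& Defs.is_left v == Defs.is_left w, Defs.is_left x == Defs.is_left y,
      (minn (pos x) (pos y) < minn (pos v) (pos w))%N
    & (maxn (pos v) (pos w) < maxn (pos x) (pos y))%N].

Ltac ltn_cases :=
  repeat match goal with |- context [(?a < ?b)%N] => case: (ltnP a b) => ? end;
  simpl; try reflexivity; exfalso; lia.

(** The sum [higher x v (+) higher y v] is the parity of the number of ends preceding [v] along
    [pos]: in the right column the ends above [v] come after it, but there are two ends in all, so
    the parities agree. Without a crossing, an even number of ends lies between [v] and [w]. *)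
Lemma noncrossing_higher_lt (x y v w : vtx) :
  (pos x < pos y)%N -> (pos v < pos w)%N ->
  pos v <> pos x -> pos v <> pos y -> pos w <> pos x -> pos w <> pos y ->
  (pos x < pos v -> pos v < pos y -> pos w < pos y)%N -> 
  (pos v < pos x -> pos x < pos w -> pos y < pos w)%N -> 
  higher x v (+) higher y v = higher x w (+) higher y w.
Proof.
case: x => -[x Hx]; case: y => -[y Hy]; case: v => -[v Hv]; case: w => -[w Hw] /=.
all: by move=> h1 h2 h3 h4 h5 h6 h7 h8; rewrite ?addbF ?addFb ?addbb //; ltn_cases.
Qed.

Lemma noncrossing_higher (x y v w : vtx) :
  pos v <> pos x -> pos v <> pos y -> pos w <> pos x -> pos w <> pos y ->
  pos v <> pos w -> pos x <> pos y ->
  ~~ crossing x y v w -> ~~ crossing x y w v -> ~~ crossing y x v w -> ~~ crossing y x w v ->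
  ~~ crossing v w x y -> ~~ crossing v w y x -> ~~ crossing w v x y -> ~~ crossing w v y x ->
  higher x v (+) higher y v = higher x w (+) higher y w.
Proof.
have W (a b c d : vtx) : pos c <> pos b -> pos d <> pos b -> pos a <> pos d ->
    (pos a < pos b)%N -> (pos c < pos d)%N ->
    pos c <> pos a -> pos d <> pos a ->
    ~~ crossing a b c d -> ~~ crossing c d a b ->
    higher a c (+) higher b c = higher a d (+) higher b d.
  rewrite /crossing => h1 h2 h3 h4 h5 h6 h7 /and3P h8 /and3P h9.
  apply: noncrossing_higher_lt => // [? ?|? ?].
    by case: (ltngtP (pos d) (pos b)) => // ?; case: h8.
  by case: (ltngtP (pos b) (pos d)) => // [?|]; [case: h9|move/esym].
move=> vx vy wx wy vw xy c1 c2 c3 c4 c5 c6 c7 c8.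
case: (ltngtP (pos x) (pos y)) xy => // xy _; case: (ltngtP (pos v) (pos w)) vw => // vw _.
- by apply: W => //; apply/nesym.
- by apply/esym/W => //; apply/nesym.
- by rewrite [LHS]addbC [RHS]addbC; apply: W => //; apply/nesym.
- by rewrite [LHS]addbC [RHS]addbC; apply/esym/W => //; apply/nesym.
Qed.

(** If the parity were odd, [v] and [w] would both lie strictly between [x] and [y] on the boundary.
    For an edge joining the columns this means below it, for an edge within a column it means nested
    inside it. *)
Lemma outermost_higher (x y v w : vtx) :
  pos v <> pos x -> pos v <> pos y -> pos w <> pos x -> pos w <> pos y ->
  higher x v (+) higher y v = higher x w (+) higher y w ->
  below_at x y v -> below_at y x v -> ~~ nested_in v w x y ->
  higher x v (+) higher y v = false.
Proof.
rewrite /nested_in.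
case: x => -[x Hx]; case: y => -[y Hy]; case: v => -[v Hv]; case: w => -[w Hw] /=.
all: move=> h1 h2 h3 h4; rewrite ?addbF ?addFb ?addbb //=.
all: (repeat match goal with |- context [(?a < ?b)%N] => case: (ltnP a b) => ? end;
  rewrite /=; intros; try reflexivity; exfalso; lia).
Qed.

Lemma higher_noncrossing (x y v w : vtx) :
  pos v <> pos x -> pos v <> pos y -> pos w <> pos x -> pos w <> pos y ->
  higher x v (+) higher y v = higher x w (+) higher y w -> ~~ crossing x y v w.
Proof.
rewrite /crossing.
case: x => -[x Hx]; case: y => -[y Hy]; case: v => -[v Hv]; case: w => -[w Hw] /=.
all: move=> h1 h2 h3 h4; rewrite ?addbF ?addFb ?addbb //=.
all: (repeat match goal with |- context [(?a < ?b)%N] => case: (ltnP a b) => ? end;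
  rewrite /=; intros; try reflexivity; try discriminate; exfalso; lia).
Qed.

Lemma higher_below_at (x y v : vtx) : higher x v (+) higher y v = false -> below_at x y v.
Proof.
by case: x => x; case: y => y; case: v => v //=; rewrite ?addbF ?addFb; case: ltnP.
Qed.

Lemma higher_between (x y v : vtx) : Defs.is_left x == Defs.is_left y ->
  (minn (pos x) (pos y) < pos v)%N -> (pos v < maxn (pos x) (pos y))%N ->
  higher x v (+) higher y v.
Proof.
wlog xy : x y / (pos x <= pos y)%N => [W|].
  by case/orP: (leq_total (pos x) (pos y)) => /W // h; rewrite minnC maxnC eq_sym addbC.
rewrite (minn_idPl xy) (maxn_idPr xy) => + h1 h2; move: h1 h2 {xy}.
case: x => -[x Hx]; case: y => -[y Hy] //=; case: v => -[v Hv] /= + + _; try lia.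
all: by case: (ltnP x v) => ?; case: (ltnP y v) => //=; lia.
Qed.

Lemma higher_outermost (x y v w : vtx) :
  higher x v (+) higher y v = false -> ~~ nested_in v w x y.
Proof.
move=> h; apply/and4P => -[_ e]; rewrite ltn_min gtn_max => /andP[h1 _] /andP[h2 _].
by have := higher_between e h1 h2; rewrite h.
Qed.

(* Parity form of the diagram axioms: an edge does not separate the two ends of another edge,
   and a decorated edge is one that can be pulled to the top side. *)
Definition planar_blob (m : vtx -> vtx) (b : vtx -> bool) :=
  forall x v, v != x -> v != m x ->
    sep m x v = sep m x (m v) /\ (b v -> sep m x v = false).

Lemma planar_of_blob_diagram (x : {ffun vtx -> vtx} * {ffun vtx -> bool}) :
  is_blob_diagram x ->
  [/\ involutive x.1, forall v, x.1 v != v, forall v, x.2 (x.1 v) = x.2 v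
    & planar_blob x.1 x.2].
Proof.
case: x => m b /and5P[/= /forallP h1 h2 /forallP h3 h4 h5].
have mK : involutive m by move=> v; have /andP[/eqP] := h1 v.
have mN v : m v != v by have /andP[] := h1 v.
split=> //= [v|x v vx vm]; first exact/eqP.
have cr a c : ~~ [&& (pos a < pos c)%N, (pos c < pos (m a))%N & (pos (m a) < pos (m c))%N].
  by move/forallP: h2 => /(_ a)/forallP/(_ c).
have vx' := pos_neq vx; have vm' := pos_neq vm.
have mvx : pos (m v) <> pos x by move=> /pos_inj e; move: vm; rewrite -e mK eqxx.
have mvm : pos (m v) <> pos (m x) by move=> /pos_inj e; move: vx; rewrite -(mK v) e mK eqxx.
have mv' := nesym (pos_neq (mN v)); have mx' := nesym (pos_neq (mN x)).
have := (cr x v, cr x (m v), cr (m x) v, cr (m x) (m v), cr v x, cr v (m x), cr (m v) x, cr (m v) (m x)).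
rewrite !mK => -[[[[[[[c1 c2] c3] c4] c5] c6] c7] c8].
have E : sep m x v = sep m x (m v) by exact: noncrossing_higher.
split=> //.
move=> bv; apply: (@outermost_higher _ _ v (m v)) => //.
- case: x {vx vm vx' vm' mvx mvm mx' c1 c2 c3 c4 c5 c6 c7 c8 E} => // i; case e: (m _) => [|j] //.
  move/forallP: h4 => /(_ v)/forallP/(_ i); rewrite /above /propag e bv /=.
  by case: (v).
- case e : (m x) => [i|//]; case e' : x => [|j] //.
  move/forallP: h4 => /(_ v)/forallP/(_ i); have mi : m (inl i) = inr j by rewrite -e mK.
  rewrite /above /propag mi bv /=.
  by case: (v).
move/forallP: h5 => /(_ v)/forallP/(_ x); rewrite /propag bv /= !negbK.
by rewrite /lo /hi /nested_in.
Qed.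

Lemma blob_diagram_of_planar (x : {ffun vtx -> vtx} * {ffun vtx -> bool}) :
  involutive x.1 -> (forall v, x.1 v != v) -> (forall v, x.2 (x.1 v) = x.2 v) ->
  planar_blob x.1 x.2 -> is_blob_diagram x.
Proof.
case: x => m b /= mK mN bm pl.
have dis x v : v != x -> v != m x ->
    [/\ pos v <> pos x, pos v <> pos (m x), pos (m v) <> pos x & pos (m v) <> pos (m x)].
  move=> vx vm; split; try exact: pos_neq.
    by apply: pos_neq; rewrite (inv_eq mK).
  by apply: pos_neq; rewrite (inj_eq (inv_inj mK)).
apply/and5P; split=> /=.
- by apply/forallP => v; rewrite mK eqxx mN.
- apply/forallP => x; apply/forallP => v.
  case: (eqVneq v x) => [->|vx]; first by rewrite ltnn.
  case: (eqVneq v (m x)) => [->|vm]; first by rewrite ltnn andbF.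
  have [d1 d2 d3 d4] := dis _ _ vx vm.
  exact: higher_noncrossing (pl _ _ vx vm).1.
- by apply/forallP => v; rewrite bm.
- apply/forallP => v; apply/forallP => i; apply/implyP => /andP[bv].
  case: (eqVneq v (inl i)) => [-> _|vx]; first by rewrite /= leqnn.
  case: (eqVneq v (m (inl i))) => [->|vm]; first by rewrite /propag /above; case: (m _).
  have [d1 d2 d3 d4] := dis _ _ vx vm.
  have := higher_below_at ((pl _ _ vx vm).2 bv).
  by rewrite /propag /above; case: (m (inl i)) => // j; case: (v).
apply/forallP => v; apply/forallP => x.
case: (eqVneq v x) => [->|vx]; first by rewrite ltnn !andbF.
case: (eqVneq v (m x)) => [->|vm]; first by rewrite /lo mK [X in (X < _)%N]minnC ltnn !andbF.
have [d1 d2 d3 d4] := dis _ _ vx vm.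
case bv: (b v) => //=.
have := higher_outermost (m v) ((pl _ _ vx vm).2 bv).
by rewrite /nested_in /propag !negbK /lo /hi.
Qed.
End Planarity.

(** * Composition of diagrams *)

(* [M] and [G] generate a dihedral action; on the orbit of [u] under [G \o M], of length [k],
   they act as [i |-> - i - 1] and [i |-> - i], so [k] is even and [G] fixes exactly [0] and [k / 2]. *)
Lemma two_ends (T : finType) (M G : T -> T) (r : rel T) (u : T) :
  involutive M -> involutive G -> (forall x, M x != x) -> G u = u ->
  (forall x, connect r x (M x)) -> (forall x, connect r x (G x)) ->
  (forall x y, r x y -> y = M x \/ y = G x) ->
  exists w, [/\ connect r u w, G w = w, w != u &
    forall z, connect r u z -> G z = z -> z = u \/ z = w].
Proof.
move=> MK GK MN Gu rM rG rMG; pose f := G \o M.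
have finj : injective f by apply: inj_comp; apply: inv_inj.
pose k := order f u; have k0 : (0 < k)%N by apply: order_gt0.
have fk : iter k f u = u by apply: iter_order.
have Gf i : (i <= k)%N -> G (iter i f u) = iter (k - i) f u.
  elim: i => [|i IH] ik; first by rewrite subn0 fk.
  apply: finj; rewrite -iterS -subSn // subSS -IH; last exact: ltnW.
  by rewrite /f /= GK MK.
have Mf i : (i < k)%N -> M (iter i f u) = iter (k - i.+1) f u.
  by move=> ik; rewrite -Gf // iterS /f /= GK.
have uniq_i i j : (i < k)%N -> (j < k)%N -> iter i f u = iter j f u -> i = j.
  by move=> ik jk e; rewrite -(findex_iter ik) e findex_iter.
have orb z : connect r u z -> exists2 i, (i < k)%N & z = iter i f u.
  move=> /connectP[p + ->]; elim/last_ind: p => [_|p x IH]; first by exists 0%N.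
  rewrite rcons_path last_rcons => /andP[/IH[i ik ->]] /rMG[->|->].
    by exists (k - i.+1)%N; rewrite ?Mf //; lia.
  case: i ik => [|i] ik; first by exists 0%N; rewrite //= Gu.
  by exists (k - i.+1)%N; rewrite ?Gf //; lia.
have conn i : connect r u (iter i f u).
  elim: i => [|i IH]; first exact: connect0.
  by rewrite iterS /f /=; apply: connect_trans (rG _); apply: connect_trans (rM _).
(* For odd [k = 2h + 1] the point [f^h u] would be fixed by [M]. *)
have kE : k = (k./2 + k./2)%N.
  rewrite addnn; have := odd_double_half k; case: odd => //= e.
  have ik : (k./2 < k)%N by lia.
  by have := MN (iter k./2 f u); rewrite Mf // (_ : k - _ = k./2)%N ?eqxx //; lia.
have hk : (k./2 < k)%N by lia.
exists (iter k./2 f u); split=> //.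
- by rewrite Gf ?(ltnW hk) //; congr iter; lia.
- by apply/eqP => e; have := uniq_i _ 0%N hk k0 e; lia.
move=> z /orb[i ik ->]; rewrite Gf ?(ltnW ik) // => e.
case: i ik e => [|i] ik e; first by left.
right; suff -> : i.+1 = k./2 by [].
by have := uniq_i _ _ _ ik e; lia.
Qed.

Section Compose.
Variable n : nat.
Notation vtx := (vtx n).
Notation wv := (wv n).
Notation diag := (diag n).
Implicit Types d e : diag.

Lemma diagP d : [/\ involutive (val d).1, forall v, (val d).1 v != v,
  forall v, (val d).2 ((val d).1 v) = (val d).2 v & planar_blob (val d).1 (val d).2].
Proof. exact: planar_of_blob_diagram (valP d). Qed.

Section Two.
Variables d1 d2 : diag.
Notation m1 := (val d1).1.
Notation m2 := (val d2).1.

(** Paths of [crel] alternate between two involutions, and the outer vertices are the fixed points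
    of [glue_step]; this is the setting of [two_ends]. *)
Definition edge_step (x : wv) : wv :=
  match x with inl u => inl (m1 u) | inr u => inr (m2 u) end.
Definition glue_step (x : wv) : wv :=
  match x with
  | inl (inr j) => inr (inl j)
  | inr (inl j) => inl (inr j)
  | _ => x
  end.

Lemma edge_stepK : involutive edge_step.
Proof.
by case=> u /=; [have [h _ _ _] := diagP d1 | have [h _ _ _] := diagP d2]; rewrite h.
Qed.

Lemma glue_stepK : involutive glue_step.
Proof. by move=> [[]|[]]. Qed.

Lemma edge_step_neq x : edge_step x != x.
Proof.
case: x => u /=; [have [_ h _ _] := diagP d1 | have [_ h _ _] := diagP d2].
  by apply: contra (h u) => /eqP[->].
by apply: contra (h u) => /eqP[->].
Qed.

Lemma glue_step_outer x : (glue_step x == x) = outer x.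
Proof. by move: x => [[]|[]] i //=; rewrite eqxx. Qed.

Lemma emb_outer (v : vtx) : outer (emb v).
Proof. by case: v. Qed.

Lemma outer_emb x : outer x -> exists v : vtx, x = emb v.
Proof. by move: x => [[]|[]] i //= _; [exists (inl i) | exists (inr i)]. Qed.

Lemma emb_inj : injective (@emb n).
Proof. by move=> [i|i] [j|j] //= [->]. Qed.

Notation conn := (connect (crel d1 d2)).

Lemma crel_edge x : crel d1 d2 x (edge_step x).
Proof. by case: x => -[u|u] /=; rewrite eqxx. Qed.

Lemma conn_glue x : conn x (glue_step x).
Proof.
by move: x => [[i|i]|[i|i]] /=; rewrite ?connect0 //; apply: connect1; rewrite /= eqxx.
Qed.

Lemma crel_steps x y : crel d1 d2 x y -> y = edge_step x \/ y = glue_step x.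
Proof.
case: x y => [u|u] [v|v] /=; [by case: u => u /eqP <-; left| | | by case: u => u /eqP <-; left].
  by case: u v => [i|i] [j|j] // /eqP <-; right.
by case: u v => [i|i] [j|j] // /eqP <-; right.
Qed.

Lemma conn_sym : connect_sym (crel d1 d2).
Proof.
apply: sym_connect_sym => -[u|u] [v|v] /=.
- have [mK _ _ _] := diagP d1.
  by case: u => u; case: v => v; rewrite (inv_eq mK) eq_sym.
- by case: u => u; case: v => v //; rewrite eq_sym.
- by case: u => u; case: v => v //; rewrite eq_sym.
have [mK _ _ _] := diagP d2.
by case: u => u; case: v => v; rewrite (inv_eq mK) eq_sym.
Qed.

Lemma conn_edge x y : conn x y -> conn x (edge_step y).
Proof. by move=> h; apply: connect_trans h (connect1 (crel_edge y)). Qed.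

Lemma outer_partner (v : vtx) : exists w : vtx, [/\ conn (emb v) (emb w), w != v &
  forall z : vtx, conn (emb v) (emb z) -> z = v \/ z = w].
Proof.
have [w [vw /eqP]] := two_ends edge_stepK glue_stepK edge_step_neq
  (elimT eqP (etrans (glue_step_outer (emb v)) (emb_outer v)))
  (fun x => connect1 (crel_edge x)) conn_glue crel_steps.
rewrite glue_step_outer => /outer_emb[w' e] wv h; subst w; exists w'; split=> //.
  by apply: contra wv => /eqP ->.
move=> z vz; have /eqP ez : glue_step (emb z) == emb z by rewrite glue_step_outer emb_outer.
by case: (h _ vz ez) => /emb_inj; auto.
Qed.

Definition partner (v : vtx) : vtx := odflt v [pick w | (w != v) && conn (emb v) (emb w)].

Lemma partnerP v w : (partner v == w) = (v != w) && conn (emb v) (emb w).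
Proof.
rewrite /partner; case: pickP => [x /andP[xv vx]|h] /=; last first.
  have [x [vx xv _]] := outer_partner v.
  by have := h x; rewrite xv vx.
have [y [vy yv hy]] := outer_partner v.
have xy : x = y by case: (hy _ vx) => // e; rewrite e eqxx in xv.
apply/eqP/andP => [<-|[vw cw]]; first by rewrite eq_sym.
by case: (hy _ cw) => [e|->]; rewrite // e eqxx in vw.
Qed.

Definition partner_blob (v : vtx) : bool := [exists x, conn (emb v) x && wblob d1 d2 x].

Definition composite_data : {ffun vtx -> vtx} * {ffun vtx -> bool} :=
  ([ffun v => partner v], [ffun v => partner_blob v]).

End Two.

Definition column_parity (A : pred vtx) (v : vtx) : bool :=
  \big[addb/false]_(x | A x) higher x v.

Lemma column_parityL A j :
  column_parity A (inl j) = \big[addb/false]_(i : 'I_n | A (inl i)) (i < j)%N.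
Proof.
rewrite /column_parity big_sumType /= [X in _ (+) X]big1 ?addbF //.
Qed.

Lemma column_parityR A j :
  column_parity A (inr j) = \big[addb/false]_(i : 'I_n | A (inr i)) (i < j)%N.
Proof.
rewrite /column_parity big_sumType /= [X in X (+) _]big1 ?addFb //.
Qed.

(** Counting each edge inside [A] once, at its end of smaller [pos], turns a sum over vertices into
    a sum of separation parities, to which [planar_blob] applies termwise. *)
Lemma column_parity_edges d (A : pred vtx) v :
  (forall x, A x -> A ((val d).1 x)) ->
  column_parity A v =
    \big[addb/false]_(x | A x && (pos x < pos ((val d).1 x))%N) sep (val d).1 x v.
Proof.
move=> Am; have [mK mN _ _] := diagP d; set m := (val d).1 in Am mK mN *.
have AmE x : A (m x) = A x by apply/idP/idP => /Am; rewrite ?mK.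
rewrite /column_parity (bigID (fun x => pos x < pos (m x))%N) /= big_split /=; congr (_ (+) _).
rewrite (reindex_inj (inv_inj mK)); apply: eq_big => // x; rewrite AmE mK.
case: ltngtP => // /pos_inj/eqP e; move: (mN x); by rewrite 1?eq_sym ?e // eq_sym e.
Qed.

Lemma column_parity_closed d (A : pred vtx) v :
  (forall x, A x -> A ((val d).1 x)) -> ~~ A v ->
  column_parity A v = column_parity A ((val d).1 v) /\
  ((val d).2 v -> column_parity A v = false).
Proof.
move=> Am Av; have [mK mN _ pl] := diagP d.
have h x : A x -> v != x /\ v != (val d).1 x.
  by move=> Ax; split; apply: contra Av => /eqP -> //; apply: Am.
rewrite !(column_parity_edges _ Am); split.
  by apply: eq_bigr => x /andP[/h[vx vm] _]; apply: (pl _ _ vx vm).1.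
move=> bv; apply: big1 => x /andP[/h[vx vm] _]; exact: (pl _ _ vx vm).2.
Qed.

(* Let [A] be the component of an outer vertex.  The parity of the number of vertices of [A] above
   a given vertex in its column is constant along every path avoiding [A], and even at its blobs;
   at the outer vertices it is the separation parity of the composite. *)
Lemma composite_planar d1 d2 : is_blob_diagram (composite_data d1 d2).
Proof.
set conn := connect (crel d1 d2).
have pE v : (composite_data d1 d2).1 v = partner d1 d2 v by rewrite ffunE.
have bE v : (composite_data d1 d2).2 v = partner_blob d1 d2 v by rewrite ffunE.
have pC v : conn (emb v) (emb (partner d1 d2 v)).
  by have := partnerP d1 d2 v (partner d1 d2 v); rewrite eqxx => /esym/andP[].
have pN v : v != partner d1 d2 v.
  by have := partnerP d1 d2 v (partner d1 d2 v); rewrite eqxx => /esym/andP[].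
have cs y z : conn y z = conn z y by apply: conn_sym.
apply: blob_diagram_of_planar.
- by move=> v; rewrite !pE; apply/eqP; rewrite partnerP eq_sym pN -/conn cs pC.
- by move=> v; rewrite pE eq_sym.
- move=> v; rewrite pE !bE; apply: eq_existsb => x; congr andb.
  exact/esym/(same_connect (@conn_sym d1 d2)).
move=> x v vx; rewrite pE => vm.
pose A := conn (emb x).
have xp z : A (emb z) = (z == x) || (z == partner d1 d2 x).
  apply/idP/orP => [h|[/eqP->|/eqP->]]; [|exact: connect0|exact: pC].
  by case: eqVneq => [_|zx]; [left|right; rewrite eq_sym partnerP eq_sym zx; exact: h].
pose side y := match y with
  | inl w => column_parity (fun z => A (inl z)) w
  | inr w => column_parity (fun z => A (inr z)) w end.
have AE y : A y -> A (edge_step d1 d2 y) by apply: conn_edge.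
have AG y : A (glue_step y) = A y.
  apply/idP/idP => h; last exact: connect_trans h (conn_glue _ _ y).
  by rewrite -(glue_stepK y); apply: connect_trans h (conn_glue _ _ _).
have A1 z : A (inl z) -> A (inl ((val d1).1 z)) by move/AE.
have A2 z : A (inr z) -> A (inr ((val d2).1 z)) by move/AE.
have sE y : ~~ A y -> side (edge_step d1 d2 y) = side y.
  by case: y => w Aw /=; apply/esym; [apply: (column_parity_closed A1 Aw).1 | apply: (column_parity_closed A2 Aw).1].
have sB y : ~~ A y -> wblob d1 d2 y -> side y = false.
  by case: y => w Aw /=; [apply: (column_parity_closed A1 Aw).2 | apply: (column_parity_closed A2 Aw).2].
have sG y : side (glue_step y) = side y.
  have AGi i : A (inl (inr i)) = A (inr (inl i)) := AG (inr (inl i)).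
  by move: y => [[i|i]|[i|i]] //=; rewrite column_parityL column_parityR;
    apply: eq_bigl => j; rewrite AGi.
have sC y z : ~~ A y -> conn y z -> side y = side z.
  move=> Ay /connectP[p + ->]; elim: p y Ay => [//|w p IH] y Ay /= /andP[yw pp].
  have Aw : ~~ A w by apply: contra Ay => Aw; apply: connect_trans Aw _; rewrite -/conn cs; apply: connect1.
  rewrite -IH //; case: (crel_steps yw) => ->; by rewrite ?sE ?sG.
have Av : ~~ A (emb v) by rewrite xp negb_or vx.
(* The only outer vertices in [A] are [x] and its partner, so the column sum has just two terms. *)
have sS w : side (emb w) = sep (composite_data d1 d2).1 x w.
  rewrite /sep pE; have <- : column_parity (fun z => A (emb z)) w = higher x w (+) higher (partner d1 d2 x) w.
    rewrite /column_parity (bigD1 x) ?xp ?eqxx //= (bigD1 (partner d1 d2 x)) /=; last first.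
      by rewrite xp eqxx orbT eq_sym pN.
    by rewrite big1 ?addbF // => z; rewrite xp; case: eqVneq => //= _; case: eqVneq.
  by case: w => w /=; rewrite ?column_parityL ?column_parityR.
rewrite -!sS pE; split; first exact: sC.
rewrite bE => /existsP[y /andP[vy yb]].
rewrite (sC _ _ Av vy); apply: sB yb.
by apply: contra Av => Ay; apply: connect_trans Ay _; rewrite -/conn cs.
Qed.

Definition diag_mul d1 d2 : diag := Sub (composite_data d1 d2) (composite_planar d1 d2).

Lemma composite_diag_mul d1 d2 : composite d1 d2 (diag_mul d1 d2).
Proof.
apply/andP; split; apply/forallP => u.
  by apply/forallP => w; rewrite SubK ffunE partnerP.
by rewrite SubK ffunE.
Qed.

Lemma compositeE d1 d2 e : composite d1 d2 e = (e == diag_mul d1 d2).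
Proof.
apply/idP/eqP => [|->]; last exact: composite_diag_mul.
move=> /andP[/forallP h1 /forallP h2]; have /andP[/forallP k1 /forallP k2] := composite_diag_mul d1 d2.
apply: val_inj; rewrite [LHS]surjective_pairing [RHS]surjective_pairing; congr pair.
  apply/ffunP => u; apply/eqP; have /forallP/(_ ((val (diag_mul d1 d2)).1 u))/eqP -> := h1 u.
  by have /forallP/(_ ((val (diag_mul d1 d2)).1 u))/eqP <- := k1 u.
by apply/ffunP => u; rewrite (eqP (h2 u)) (eqP (k2 u)).
Qed.
End Compose.

(** * Counting colourings *)

Section Colour.
Variable n : nat.
Notation vtx := (vtx n).
Notation wv := (wv n).
Notation diag := (diag n).
Notation colouring := {ffun 'I_n -> 'I_3}.
Implicit Types d e : diag.

(* Three colours, of which [ord_max] is forbidden on blobs: a loop then contributes a factor 3 or 2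
   to the number of colourings, and [3 ^ p * 2 ^ q] determines [p] and [q]. *)
Definition compat d (c : vtx -> 'I_3) : bool :=
  [forall v, (c ((val d).1 v) == c v) && ((val d).2 v ==> (c v != ord_max))].

Definition join (cL cR : colouring) (v : vtx) : 'I_3 :=
  match v with inl i => cL i | inr j => cR j end.

Lemma compatP d c : reflect (forall v, c ((val d).1 v) = c v /\ ((val d).2 v -> c v != ord_max))
  (compat d c).
Proof.
apply: (iffP forallP) => h v; first by have /andP[/eqP ? /implyP ?] := h v.
by have [-> /implyP ->] := h v; rewrite eqxx.
Qed.

Section Count.
Variables (d1 d2 : diag) (cL cR : colouring).
Notation conn := (connect (crel d1 d2)).
Notation wcomp := (wcomp d1 d2).
Notation loops := (loops d1 d2).
Notation e := (diag_mul d1 d2).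
Notation c := (join cL cR).

(** Both copies of a middle vertex read the same [mid], so glue steps preserve colours by
    construction and only the edges impose conditions. *)
Definition middle_colour (mid : colouring) (x : wv) : 'I_3 :=
  match x with
  | inl (inl i) => cL i | inl (inr j) => mid j
  | inr (inl j) => mid j | inr (inr j) => cR j
  end.

Lemma wcompP x y : reflect (wcomp x = wcomp y) (conn x y).
Proof.
apply: (iffP idP) => [h|h].
  by apply/setP => z; rewrite !inE; apply: (same_connect (@conn_sym _ d1 d2)).
have : y \in wcomp y by rewrite inE connect0.
by rewrite -h inE.
Qed.

Lemma mem_loops x : (wcomp x \in loops) = [forall y, conn x y ==> ~~ outer y].
Proof.
apply/imsetP/idP => [[y /= h /wcompP xy]|h]; last by exists x.
apply/forallP => z; move/forallP: h => /(_ z).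
by rewrite (same_connect (@conn_sym _ d1 d2) xy).
Qed.

Lemma middle_valid mid : compat d1 (join cL mid) && compat d2 (join mid cR) =
  [forall x, (middle_colour mid (edge_step d1 d2 x) == middle_colour mid x) &&
    (wblob d1 d2 x ==> (middle_colour mid x != ord_max))].
Proof.
have jL v : join cL mid v = middle_colour mid (inl v) by case: v.
have jR v : join mid cR v = middle_colour mid (inr v) by case: v.
apply/andP/forallP => [[/compatP h1 /compatP h2] [u|u]|h].
- by have := h1 u; rewrite !jL => -[/eqP ? /implyP ?]; apply/andP.
- by have := h2 u; rewrite !jR => -[/eqP ? /implyP ?]; apply/andP.
split; apply/forallP => u; rewrite ?jL ?jR; [exact: (h (inl u)) | exact: (h (inr u))].
Qed.

Lemma middle_const mid x y :
  (forall x, middle_colour mid (edge_step d1 d2 x) = middle_colour mid x) ->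
  conn x y -> middle_colour mid x = middle_colour mid y.
Proof.
move=> h /connectP[p + ->]; elim: p x => [//|z p IH] x /= /andP[/crel_steps xz /IH <-].
by case: xz => ->; rewrite ?h //; move: x => [[]|[]].
Qed.

Lemma middle_emb mid v : middle_colour mid (emb v) = c v.
Proof. by case: v. Qed.

Definition outer_colour (C : {set wv}) : 'I_3 :=
  if [pick v : vtx | emb v \in C] is Some v then c v else ord0.

Definition loop_colour (h : {ffun {set wv} -> 'I_3}) (x : wv) : 'I_3 :=
  if wcomp x \in loops then h (wcomp x) else outer_colour (wcomp x).

Definition allowed (C : {set wv}) : pred 'I_3 :=
  fun k => [exists y in C, wblob d1 d2 y] ==> (k != ord_max).

Definition loop_middle (h : {ffun {set wv} -> 'I_3}) : colouring :=
  [ffun j => loop_colour h (inl (inr j))].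

Lemma loop_colour_conn h x y : conn x y -> loop_colour h x = loop_colour h y.
Proof. by rewrite /loop_colour => /wcompP ->. Qed.

Lemma not_loop x : wcomp x \notin loops -> exists v, conn x (emb v).
Proof.
rewrite mem_loops negb_forall => /existsP[y]; rewrite negb_imply negbK.
by move=> /andP[xy /outer_emb[v e]]; exists v; rewrite -e.
Qed.

Lemma outer_colourE : compat e c -> forall x v, conn x (emb v) -> outer_colour (wcomp x) = c v.
Proof.
move=> /compatP ec x v xv; rewrite /outer_colour; case: pickP => [w|/(_ v)]; last by rewrite inE xv.
rewrite inE => xw; case: (eqVneq v w) => [->//|vw].
have vw' : conn (emb v) (emb w) by rewrite conn_sym in xv; apply: connect_trans xv xw.
have [<- _] := ec v; congr join; apply/eqP.
by rewrite eq_sym SubK ffunE partnerP vw.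
Qed.

Lemma compat_blob : compat e c -> forall x v, conn (emb v) x -> wblob d1 d2 x -> c v != ord_max.
Proof.
move=> /compatP ec x v vx xb; apply: (ec v).2.
by rewrite SubK ffunE; apply/existsP; exists x; rewrite vx.
Qed.

Lemma middle_loop h : compat e c -> middle_colour (loop_middle h) =1 loop_colour h.
Proof.
move=> ec; have L v : loop_colour h (emb v) = c v.
  rewrite /loop_colour mem_loops; case: ifP => [/forallP/(_ (emb v))|_].
    by rewrite connect0 emb_outer.
  by apply: outer_colourE.
move=> [[i|i]|[i|i]] /=; rewrite ?ffunE.
- by rewrite (L (inl i)).
- by [].
- by apply: loop_colour_conn; apply: (conn_glue d1 d2 (inl (inr i))).
- by rewrite (L (inr i)).
Qed.

(** A valid colouring is constant on components. On a component reaching an outer vertex it is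
    forced by [c]; on a loop it is any allowed colour, chosen independently of the other loops. *)
Lemma card_middle : compat e c ->
  #|[set mid | compat d1 (join cL mid) && compat d2 (join mid cR)]| =
  (\prod_(C in loops) #|allowed C|)%N.
Proof.
move=> ec; have -> : [set mid | compat d1 (join cL mid) && compat d2 (join mid cR)] =
    loop_middle @: pfamily ord0 (mem loops) allowed.
  apply/setP => mid; rewrite inE middle_valid; apply/forallP/imsetP.
    move=> hm; have hE x : middle_colour mid (edge_step d1 d2 x) = middle_colour mid x.
      by have /andP[/eqP] := hm x.
    pose h := [ffun C : {set wv} => if C \in loops then
      (if [pick x in C] is Some x then middle_colour mid x else ord0) else ord0].
    have hx x : wcomp x \in loops -> h (wcomp x) = middle_colour mid x.
      rewrite ffunE => ->; case: pickP => [y|/(_ x)]; rewrite inE ?connect0 // => xy.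
      exact/esym/middle_const.
    exists h.
      apply/pfamilyP; split=> [|C CL].
        by apply/supportP => C /negPf; rewrite ffunE => ->.
      have /imsetP[x _ Cx] := CL; rewrite Cx in CL *; rewrite unfold_in hx // /allowed.
      apply/implyP => /existsP[y /andP[]]; rewrite inE => xy yb.
      rewrite (middle_const hE xy); have /andP[_ /implyP] := hm y; exact.
    apply/ffunP => j; rewrite ffunE /loop_colour; case: ifP => [/hx -> //|/negbT/not_loop[v xv]].
    by rewrite (outer_colourE ec xv) -(middle_emb mid) -(middle_const hE xv).
  move=> [h /pfamilyP[_ hF] ->] x; rewrite !(middle_loop _ ec); apply/andP; split.
    apply/eqP/esym/loop_colour_conn/connect1/crel_edge.
  apply/implyP => xb; rewrite /loop_colour; case: ifP => [L|/negbT/not_loop[v xv]].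
    have := hF _ L; rewrite unfold_in /allowed => /implyP; apply.
    by apply/existsP; exists x; rewrite inE connect0.
  rewrite (outer_colourE ec xv); apply: (compat_blob ec _ xb).
  by rewrite conn_sym.
rewrite card_in_imset ?card_pfamily; first by rewrite foldrE big_map big_enum.
move=> h h' /pfamilyP[/supportP s _] /pfamilyP[/supportP s' _] hh; apply/ffunP => C.
case: (boolP (C \in loops)) => CL; last by rewrite s ?s'.
have /imsetP[x /= xL Cx] := CL; rewrite Cx in CL *.
have : loop_colour h x = loop_colour h' x by rewrite -!(middle_loop _ ec) hh.
by rewrite /loop_colour CL.
Qed.

Lemma card_allowed C : #|allowed C| = if [exists y in C, wblob d1 d2 y] then 2 else 3.
Proof.
case: ifP => b; last by rewrite (eq_card (B := predT)) ?card_ord // => k; rewrite unfold_in /allowed b.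
rewrite (eq_card (B := predC1 ord_max)) ?cardC1 ?card_ord // => k.
by rewrite unfold_in /allowed b.
Qed.

(** The 0-1 matrices [compat d], with rows and columns indexed by column colourings, multiply as
    diagrams do with loop values 3 and 2. A product of diagrams becomes a product of matrices. *)
Lemma count_middle :
  (\sum_(mid : colouring) compat d1 (join cL mid) * compat d2 (join mid cR) =
  compat e c * (3 ^ nloops_plain d1 d2 * 2 ^ nloops_blob d1 d2))%N.
Proof.
under eq_bigr do rewrite mulnb.
have -> : (\sum_(mid : colouring) (compat d1 (join cL mid) && compat d2 (join mid cR)) =
    #|[set mid | compat d1 (join cL mid) && compat d2 (join mid cR)]|)%N.
  by rewrite -sum1dep_card [RHS]big_mkcond; apply: eq_bigr => mid _; case: ifP.
case: (boolP (compat e c)) => ec.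
  rewrite card_middle // mul1n; under eq_bigr do rewrite card_allowed.
  rewrite (bigID (fun C : {set wv} => [exists y in C, wblob d1 d2 y])) /= mulnC; congr (_ * _)%N.
    rewrite (eq_bigr (fun=> 3)) => [|C /andP[_ /negPf ->] //].
    rewrite prod_nat_const; congr (3 ^ _)%N; apply: eq_card => C.
    by rewrite !inE; congr andb; rewrite negb_exists; apply: eq_forallb => y; rewrite negb_and implybE.
  rewrite (eq_bigr (fun=> 2)) => [|C /andP[_ ->] //].
  by rewrite prod_nat_const; congr (2 ^ _)%N; apply: eq_card => C; rewrite !inE.
rewrite mul0n; apply/eqP; rewrite cards_eq0; apply/eqP/setP => mid; rewrite !inE.
apply: contraNF ec; rewrite middle_valid => /forallP hm.
have hE x : middle_colour mid (edge_step d1 d2 x) = middle_colour mid x.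
  by have /andP[/eqP] := hm x.
apply/compatP => v; rewrite -!(middle_emb mid); split.
  apply/esym/(middle_const hE).
  by have := partnerP d1 d2 v ((val e).1 v); rewrite SubK ffunE eqxx => /esym/andP[].
rewrite SubK ffunE => /existsP[x /andP[vx xb]]; rewrite (middle_const hE vx).
by have /andP[_ /implyP] := hm x; apply.
Qed.

Lemma compat_mulP : reflect
  (exists mid, compat d1 (join cL mid) /\ compat d2 (join mid cR)) (compat e c).
Proof.
have := count_middle; case: (boolP (compat e c)) => ec h; constructor.
  have : (\sum_(mid : colouring) compat d1 (join cL mid) * compat d2 (join mid cR) != 0)%N.
    by rewrite h mul1n muln_eq0 !expn_eq0.
  rewrite sum_nat_eq0 negb_forall => /existsP[mid]; rewrite /= muln_eq0 !eqb0 negb_or !negbK.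
  by move=> /andP[]; exists mid.
move=> [mid [h1 h2]]; move/eqP: h; rewrite mul0n sum_nat_eq0 => /forallP/(_ mid).
by rewrite h1 h2.
Qed.

End Count.

Lemma eq_compat d c c' : c =1 c' -> compat d c = compat d c'.
Proof. by move=> h; apply: eq_forallb => v; rewrite !h. Qed.

Definition left_part (c : vtx -> 'I_3) : colouring := [ffun i => c (inl i)].
Definition right_part (c : vtx -> 'I_3) : colouring := [ffun i => c (inr i)].

Lemma join_parts c : join (left_part c) (right_part c) =1 c.
Proof. by case=> i; rewrite /= ffunE. Qed.

Definition spot d (v : vtx) (k : 'I_3) : vtx -> 'I_3 :=
  fun w => if (w == v) || (w == (val d).1 v) then k else ord0.

Lemma compat_spot d v k : compat d (spot d v k) = ((val d).2 v ==> (k != ord_max)).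
Proof.
have [mK _ bm _] := diagP d.
apply/compatP/implyP => [h|h w]; first by have [_] := h v; rewrite /spot eqxx.
rewrite /spot; split; last first.
  by case: (eqVneq w v) => [->//|_]; case: (eqVneq w) => [->|//]; rewrite bm.
have -> : ((val d).1 w == v) = (w == (val d).1 v) by rewrite (inv_eq mK).
by rewrite (inj_eq (inv_inj mK)) orbC.
Qed.

Lemma compat0 d : compat d (fun=> ord0).
Proof. by apply/compatP. Qed.

(** Colouring a single edge by 1 and everything else by 0 reveals the partner of a vertex; colouring
    it by [ord_max] reveals whether it carries a blob. *)
Lemma compat_inj d d' :
  (forall cL cR, compat d (join cL cR) = compat d' (join cL cR)) -> d = d'.
Proof.
move=> h; have {}h c : compat d c = compat d' c.
  by rewrite -!(eq_compat _ (join_parts c)).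
have [mK mN bm _] := diagP d; have [mK' mN' bm' _] := diagP d'.
have mE v : (val d).1 v = (val d').1 v.
  have : compat d' (spot d v (inord 1)).
    by rewrite -h compat_spot; apply/implyP => _; rewrite -val_eqE /= inordK.
  move=> /compatP/(_ v)[+ _]; rewrite /spot eqxx (negPf (mN' v)) /=.
  by case: eqP => [->//|_] /(congr1 val); rewrite /= inordK.
apply: val_inj; rewrite [LHS]surjective_pairing [RHS]surjective_pairing; congr pair.
  exact/ffunP.
apply/ffunP => v; have := compat_spot d v ord_max; have := compat_spot d' v ord_max.
rewrite h; have -> : compat d' (spot d v ord_max) = compat d' (spot d' v ord_max).
  by apply: eq_compat => w; rewrite /spot mE.
by move=> ->; rewrite eqxx !implybF => /negb_inj.
Qed.

(** The zero colouring is compatible with every diagram and so isolates the weights; unique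
    factorisation separates the exponents. *)
Lemma weighted_compat_inj d d' p q p' q' :
  (forall cL cR, (compat d (join cL cR) * (3 ^ p * 2 ^ q) =
                  compat d' (join cL cR) * (3 ^ p' * 2 ^ q'))%N) ->
  [/\ d = d', p = p' & q = q'].
Proof.
move=> h.
have c0 e : compat e (join [ffun=> ord0] [ffun=> ord0]).
  by rewrite (eq_compat _ (c' := fun=> ord0)) ?compat0 // => -[i|i]; rewrite /= ffunE.
have e32 : (3 ^ p * 2 ^ q = 3 ^ p' * 2 ^ q')%N.
  by have := h [ffun=> ord0] [ffun=> ord0]; rewrite !c0 !mul1n.
split.
- apply: compat_inj => cL cR; have := h cL cR; rewrite e32.
  by do 2!case: compat => //; rewrite ?mul0n ?mul1n => /eqP; rewrite ?[0%N == _]eq_sym muln_eq0 !expn_eq0.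
- by have := congr1 (logn 3) e32; rewrite !lognM ?expn_gt0 // !lognX !muln1 !muln0 !addn0.
- by have := congr1 (logn 2) e32; rewrite !lognM ?expn_gt0 // !lognX !muln1 !muln0.
Qed.

Lemma diag_mul_unique a b d p q :
  (forall cL cR, (\sum_(mid : colouring) compat a (join cL mid) * compat b (join mid cR) =
    compat d (join cL cR) * (3 ^ p * 2 ^ q))%N) ->
  [/\ diag_mul a b = d, nloops_plain a b = p & nloops_blob a b = q].
Proof.
by move=> h; apply: weighted_compat_inj => cL cR; rewrite -count_middle.
Qed.

(* Both sides count the colourings of the two middle columns of a triple product. *)
Lemma diag_mulA a b d :
  [/\ diag_mul a (diag_mul b d) = diag_mul (diag_mul a b) d,
    (nloops_plain b d + nloops_plain a (diag_mul b d) =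
      nloops_plain a b + nloops_plain (diag_mul a b) d)%N
  & (nloops_blob b d + nloops_blob a (diag_mul b d) =
      nloops_blob a b + nloops_blob (diag_mul a b) d)%N].
Proof.
suff h cL cR : (compat (diag_mul a (diag_mul b d)) (join cL cR) *
    (3 ^ (nloops_plain b d + nloops_plain a (diag_mul b d)) *
     2 ^ (nloops_blob b d + nloops_blob a (diag_mul b d))) =
   compat (diag_mul (diag_mul a b) d) (join cL cR) *
    (3 ^ (nloops_plain a b + nloops_plain (diag_mul a b) d) *
     2 ^ (nloops_blob a b + nloops_blob (diag_mul a b) d)))%N.
  by apply: weighted_compat_inj.
rewrite !expnD.
have E (x p p' q q' : nat) : (x * (p * p' * (q * q')) = x * (p' * q') * (p * q))%N by ring.
rewrite !E -!count_middle !big_distrl /=.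
under eq_bigr => mid _ do rewrite -mulnA -count_middle big_distrr /=.
rewrite exchange_big /=; apply: eq_bigr => mid _.
rewrite mulnAC -count_middle big_distrl /=.
by apply: eq_bigr => mid' _; rewrite mulnA.
Qed.
End Colour.

(** * Generators and right ideals *)

Section Generators.
Variable n : nat.
Notation vtx := (vtx n).
Notation diag := (diag n).
Notation colouring := {ffun 'I_n -> 'I_3}.
Implicit Types d e : diag.

Definition ord_prev (i : 'I_n) : 'I_n := Ordinal (leq_ltn_trans (leq_pred i) (ltn_ord i)).

Definition vrow (v : vtx) : 'I_n := match v with inl i => i | inr i => i end.
Definition in_row (v : vtx) (j : 'I_n) : vtx := match v with inl _ => inl j | inr _ => inr j end.
Definition across (v : vtx) : vtx := match v with inl i => inr i | inr i => inl i end.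

Lemma sum_eqE (A B : eqType) :
  (forall a a' : A, (inl a == inl a' :> A + B) = (a == a')) *
  (forall b b' : B, (inr b == inr b' :> A + B) = (b == b')) *
  (forall a b, (inl a == inr b :> A + B) = false) *
  (forall a b, (inr b == inl a :> A + B) = false).
Proof. by []. Qed.

Lemma id_diagram : is_blob_diagram (id_data n).
Proof.
apply: blob_diagram_of_planar => /= [v|v|v|x v]; rewrite !ffunE.
- by case: v.
- by case: v.
- by [].
by case: x => x; case: v => v; rewrite /sep /= !ffunE /= ?addbF ?addFb.
Qed.

Definition id_diag : diag := Sub (id_data n) id_diagram.

Definition gen_edge (i : 'I_n) (v : vtx) : vtx :=
  if (0 < i)%N && (vrow v == i) then in_row v (ord_prev i)
  else if (0 < i)%N && (vrow v == ord_prev i) then in_row v i else across v.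

(* [i = 0] is the decorated identity, [i > 0] the undecorated cup-cap joining rows [i - 1] and [i]. *)
Definition gen_data (i : 'I_n) : {ffun vtx -> vtx} * {ffun vtx -> bool} :=
  ([ffun v => gen_edge i v], [ffun v => (i == 0%N :> nat) && (vrow v == i)]).

Lemma ord_prev_neq (i : 'I_n) : (0 < i)%N -> (ord_prev i == i) = false.
Proof. by move=> i0; rewrite -val_eqE /=; lia. Qed.

Lemma gen_edgeK i : involutive (gen_edge i).
Proof.
move=> v; rewrite {2}/gen_edge; case: posnP => i0 /=; first by rewrite /gen_edge i0; case: v.
have pN := ord_prev_neq i0.
rewrite /gen_edge i0; case: v => j /=; case: (eqVneq j i) => [->|ji] /=; rewrite ?pN ?eqxx //;
  case: (eqVneq j (ord_prev i)) => [->|jp] /=; rewrite ?eqxx //= ?(negPf ji) ?(negPf jp) //.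
Qed.

Lemma gen_diagram i : is_blob_diagram (gen_data i).
Proof.
have mE v : (gen_data i).1 v = gen_edge i v by rewrite ffunE.
apply: blob_diagram_of_planar => [v|v|v|x v].
- by rewrite !mE gen_edgeK.
- rewrite mE /gen_edge; case: posnP => i0 /=; first by case: v.
  have pN := ord_prev_neq i0.
  case: v => j /=; case: (eqVneq j i) => [->|ji] /=; rewrite ?sum_eqE ?pN //;
  by case: (eqVneq j (ord_prev i)) => [->|jp] /=; rewrite ?sum_eqE 1?eq_sym ?pN.
- rewrite mE !ffunE /gen_edge; by case: posnP => i0 //=; case: v.
rewrite /sep !mE ffunE /gen_edge; case: posnP => i0 /=.
  case: x => x; case: v => v; rewrite /= ?addbF ?addFb => _ _; split=> // /eqP->;
  by rewrite i0.
have pN := ord_prev_neq i0.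
move=> vx vm; split=> //; move: vx vm.
case: x => x /=; case: v => v /=; case: (eqVneq x i) => xi; rewrite ?xi ?pN /=;
  try (case: (eqVneq x (ord_prev i)) => xp; rewrite ?xp /=);
  case: (eqVneq v i) => vi; rewrite ?vi ?pN /=;
  try (case: (eqVneq v (ord_prev i)) => vp; rewrite ?vp /=);
  rewrite ?sum_eqE ?eqxx //= ?addbF ?addFb //;
  repeat match goal with H : is_true (_ != _) |- _ => move: H end;
  move: i0; rewrite -?val_eqE /= ?addbF ?addFb //; clear; lia.
Qed.

Definition gen i : diag := Sub (gen_data i) (gen_diagram i).

Lemma genE i v : (val (gen i)).1 v = gen_edge i v.
Proof. by rewrite SubK ffunE. Qed.

Lemma gen_blobE i v : (val (gen i)).2 v = (i == 0%N :> nat) && (vrow v == i).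
Proof. by rewrite SubK ffunE. Qed.

Lemma compat_id (cL cR : colouring) : compat id_diag (join cL cR) = (cL == cR).
Proof.
apply/compatP/eqP => [h|->].
  by apply/ffunP => j; have [] := h (inr j); rewrite SubK ffunE.
by move=> v; rewrite SubK !ffunE; case: v.
Qed.

Lemma compat_gen0 (i : 'I_n) (cL cR : colouring) : i = 0%N :> nat ->
  compat (gen i) (join cL cR) = (cL == cR) && (cL i != ord_max).
Proof.
move=> i0; apply/compatP/andP => [h|[/eqP <- h] v].
  split; first by apply/eqP/ffunP => j; have [] := h (inr j); rewrite genE /gen_edge i0.
  by have [_] := h (inl i); rewrite gen_blobE i0 !eqxx; apply.
rewrite genE gen_blobE /gen_edge i0 /=; split; first by case: v.
by case: v => v /= /eqP ->.
Qed.

Lemma compat_genP (i : 'I_n) (cL cR : colouring) : (0 < i)%N -> reflect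
  [/\ cL i = cL (ord_prev i), cR i = cR (ord_prev i) &
      forall j, j != i -> j != ord_prev i -> cL j = cR j]
  (compat (gen i) (join cL cR)).
Proof.
move=> i0; have pN := ord_prev_neq i0; apply: (iffP (compatP _ _)) => [h|[hL hR hj] v].
  split.
  - by have [] := h (inl i); rewrite genE /gen_edge i0 /= eqxx.
  - by have [] := h (inr i); rewrite genE /gen_edge i0 /= eqxx.
  move=> j ji jp; have [] := h (inr j).
  by rewrite genE /gen_edge i0 /= (negPf ji) (negPf jp).
rewrite genE gen_blobE /gen_edge i0 (gtn_eqF i0); split=> //=.
by case: v => v /=; case: (eqVneq v i) => [->//|vi]; case: (eqVneq v (ord_prev i)) => [->//|vp] /=;
  rewrite hj.
Qed.

(* The right ideals of the covering: [i = 0] asks for a blob on the top left vertex, [i > 0] for an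
   undecorated edge joining the left vertices [i - 1] and [i]. *)
Definition left_end (i : 'I_n) d : bool :=
  if i == 0%N :> nat then (val d).2 (inl i)
  else ((val d).1 (inl (ord_prev i)) == inl i) && ~~ (val d).2 (inl i).

Lemma gen_left_end i : left_end i (gen i).
Proof.
rewrite /left_end; case: eqP => i0; first by rewrite gen_blobE i0 !eqxx.
have {}i0 : (0 < i)%N by lia.
by rewrite genE gen_blobE /gen_edge i0 /= ord_prev_neq // eqxx (gtn_eqF i0) eqxx.
Qed.

(** A test colouring: a cap on rows [i - 1] and [i] is undecorated exactly when it accepts the
    forbidden colour. *)
Definition cap_colour (i : 'I_n) : colouring :=
  [ffun j => if (j == i) || (j == ord_prev i) then ord_max else ord0].

(** Expresses membership through [compat] alone, so that [compat_mulP] can carry it across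
    products. *)
Lemma left_endP (i : 'I_n) d : left_end i d <->
  if i == 0%N :> nat then forall cL cR : colouring, compat d (join cL cR) -> cL i != ord_max
  else (forall cL cR : colouring, compat d (join cL cR) -> cL i = cL (ord_prev i))
       /\ compat d (join (cap_colour i) [ffun=> ord0]).
Proof.
have [mK mN bm _] := diagP d.
rewrite /left_end; case: eqP => i0.
  split=> [b cL cR /compatP/(_ (inl i))[_]|h]; first exact.
  have := compat_spot d (inl i) ord_max; rewrite eqxx implybF => hb.
  apply: contraT; rewrite -hb -(eq_compat _ (join_parts _)) => /h.
  by rewrite ffunE /spot eqxx eqxx.
have {}i0 : (0 < i)%N by lia.
split=> [/andP[/eqP mi nb]|[h hc]].
  have mi' : (val d).1 (inl i) = inl (ord_prev i) by rewrite -mi mK.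
  split=> [cL cR /compatP/(_ (inl i))[+ _]|]; first by rewrite mi' /= => ->.
  rewrite (eq_compat _ (c' := spot d (inl i) ord_max)) ?compat_spot ?(negPf nb) //.
  by case=> j; rewrite /spot /cap_colour mi' !sum_eqE /= ffunE.
apply/andP; split.
  have : compat d (spot d (inl i) (inord 1)).
    by rewrite compat_spot; apply/implyP => _; rewrite -val_eqE /= inordK.
  rewrite -(eq_compat _ (join_parts _)) => /h.
  rewrite !ffunE /spot eqxx sum_eqE ord_prev_neq //=; case: eqP => [->|_]; first by rewrite mK.
  by move/(congr1 val); rewrite /= inordK.
apply/negP => b; move/compatP/(_ (inl i)): hc => -[_ /(_ b)].
by rewrite /= /cap_colour ffunE !eqxx.
Qed.

Lemma cap_colour_gen (i j : 'I_n) : (i.+1 < j)%N -> compat (gen j) (join (cap_colour i) (cap_colour i)).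
Proof.
move=> ij; apply/compat_genP; first by lia.
have E (k : 'I_n) : (i < k)%N -> cap_colour i k = ord0.
  by move=> ik; rewrite /cap_colour ffunE -!val_eqE /=; case: ifP => //; lia.
by split; rewrite ?E //=; lia.
Qed.

Lemma left_end_mulr i d e : left_end i d -> left_end i (diag_mul d e).
Proof.
move=> /left_endP h; apply/left_endP; case: ifP h => _.
  by move=> h cL cR /compat_mulP[mid [/h]].
move=> [h hc]; split=> [cL cR /compat_mulP[mid [/h]] //|].
apply/compat_mulP; exists [ffun=> ord0]; split=> //.
by rewrite (eq_compat _ (c' := fun=> ord0)) ?compat0 // => -[k|k]; rewrite /= ffunE.
Qed.

(** The cup and cap of [gen j] occupy rows [j - 1] and [j], both below row [i], so colours in rows
    up to [i] pass through unchanged. *)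
Lemma left_end_gen (i j : 'I_n) d : (i.+1 < j)%N -> left_end i d -> left_end i (diag_mul (gen j) d).
Proof.
move=> ij /left_endP h; apply/left_endP; have j0 : (0 < j)%N by lia.
have E (cL mid : colouring) (k : 'I_n) : (k <= i)%N -> compat (gen j) (join cL mid) -> cL k = mid k.
  by move=> ki /(compat_genP _ _ j0)[_ _]; apply; rewrite -val_eqE /=; lia.
case: ifP h => _.
  by move=> h cL cR /compat_mulP[mid [/E -> // /h]].
move=> [h hc]; split=> [cL cR /compat_mulP[mid [g /h]]|]; last first.
  by apply/compat_mulP; exists (cap_colour i); split=> //; apply: cap_colour_gen.
by rewrite (E _ _ i _ g) // (E _ _ (ord_prev i) _ g) //=; lia.
Qed.

(** For [i = 0] one edge would be both decorated and undecorated; otherwise the left vertex [i]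
    would have two partners. *)
Lemma left_end_adjacent (i j : 'I_n) d : j = i.+1 :> nat -> left_end i d -> ~~ left_end j d.
Proof.
have [mK mN bm _] := diagP d.
move=> ij; have pj : ord_prev j = i by apply: val_inj; rewrite /= ij.
rewrite /left_end ij /= pj; case: eqP => i0 h.
  by apply/negP => /andP[/eqP mi /negP]; apply; rewrite -mi bm.
move: h => /andP[/eqP mi _]; apply/negP => /andP[/eqP mi' _].
move: mi'; rewrite -mi mK => -[/(congr1 val)] /=; lia.
Qed.

(** An undecorated cap only requires equal colours at its two ends, so their common colour can be
    changed freely. *)
Lemma cap_recolour (i : 'I_n) d (mid mid' cR : colouring) : (0 < i)%N -> left_end i d ->
  mid' i = mid' (ord_prev i) -> (forall j, j != i -> j != ord_prev i -> mid' j = mid j) ->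
  compat d (join mid cR) -> compat d (join mid' cR).
Proof.
move=> i0; rewrite /left_end (gtn_eqF i0) => /andP[/eqP mi nb] e hj /compatP h.
have [mK mN bm _] := diagP d.
have mi' : (val d).1 (inl i) = inl (ord_prev i) by rewrite -mi mK.
have E v : v != inl i -> v != inl (ord_prev i) -> join mid' cR v = join mid cR v.
  by case: v => v //; rewrite !sum_eqE => ? ?; rewrite /= hj.
apply/compatP => v.
case: (eqVneq v (inl i)) => [->|vi]; first by rewrite mi' /= e (negPf nb).
case: (eqVneq v (inl (ord_prev i))) => [->|vp]; first by rewrite mi /= e -mi' bm (negPf nb).
by rewrite !E // (inv_eq mK) ?mi ?mi'.
Qed.

Lemma gen_mul (i : 'I_n) d : left_end i d ->
  [/\ diag_mul (gen i) d = d, nloops_plain (gen i) d = (0 < i)%N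
    & nloops_blob (gen i) d = 0%N].
Proof.
move=> Jd; apply: diag_mul_unique => cL cR; case: (posnP i) => i0.
  rewrite (bigD1 cL) //= big1 ?addn0.
    rewrite compat_gen0 // eqxx !muln1 /=; case: (boolP (compat d _)) => dc; last by rewrite muln0.
    by have /left_endP := Jd; rewrite i0 eqxx => /(_ _ _ dc) ->.
  by move=> mid /negPf h; rewrite compat_gen0 // eq_sym h.
rewrite muln1 expn1; under eq_bigr do rewrite mulnb.
have pN := ord_prev_neq i0.
have dL (c c' : colouring) : compat d (join c c') -> c i = c (ord_prev i).
  by have /left_endP := Jd; rewrite (gtn_eqF i0) => -[h _]; apply: h.
case: (boolP (compat d (join cL cR))) => dc; last first.
  rewrite big1 ?mul0n // => mid _; apply/eqP; rewrite eqb0; apply: contra dc.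
  move=> /andP[/(compat_genP _ _ i0)[h1 h2 h3] h]; exact: (cap_recolour i0 Jd h1 h3 h).
(* The middle colourings that fit both factors follow [cL] off the cap and take one free colour on
   it. There are three of them, which is the count for one plain loop. *)
pose rec (k : 'I_3) : colouring := [ffun j => if (j == i) || (j == ord_prev i) then k else cL j].
have recinj : injective rec by move=> k k' /ffunP/(_ i); rewrite /rec !ffunE eqxx.
rewrite mul1n -[RHS](card_ord 3) -(card_imset _ recinj) -sum1_card [RHS]big_mkcond.
apply: eq_bigr => mid _; case: imsetP => [[k _ ->]|h].
  suff -> : compat (gen i) (join cL (rec k)) && compat d (join (rec k) cR) by [].
  have E : rec k i = rec k (ord_prev i) by rewrite /rec !ffunE !eqxx orbT.
  have E' j : j != i -> j != ord_prev i -> rec k j = cL j.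
    by move=> /negPf ji /negPf jp; rewrite /rec ffunE ji jp.
  apply/andP; split; last exact: (cap_recolour i0 Jd E E' dc).
  by apply/compat_genP => //; split=> // [|j ji jp]; [apply: dL dc | rewrite E'].
apply/eqP; rewrite eqb0; apply/negP => /andP[/(compat_genP _ _ i0)[h1 h2 h3] _].
apply: h; exists (mid i) => //; apply/ffunP => j; rewrite /rec ffunE.
case: (eqVneq j i) => [->//|ji]; case: (eqVneq j (ord_prev i)) => [->//|jp] /=.
by rewrite h3.
Qed.

Lemma id_mul d : [/\ diag_mul id_diag d = d, nloops_plain id_diag d = 0%N
  & nloops_blob id_diag d = 0%N].
Proof.
apply: diag_mul_unique => cL cR; rewrite (bigD1 cL) //= big1 ?addn0.
  by rewrite compat_id eqxx mul1n muln1.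
by move=> mid /negPf h; rewrite compat_id eq_sym h.
Qed.

Lemma left_end_id i : ~~ left_end i id_diag.
Proof. by rewrite /left_end SubK !ffunE; case: ifP. Qed.

(* Take the cap whose lower end [k] is highest: it joins adjacent vertices, and if it carries a blob
   it must be the cap at the very top, so that the top vertex is decorated. *)
Lemma left_cap_left_end d (k l : 'I_n) : (val d).1 (inl k) = inl l -> exists i, left_end i d.
Proof.
have [mK mN bm pl] := diagP d.
wlog lk : k l / (l < k)%N => [W mkl|].
  case: (ltngtP l k) => [lk|kl|e]; first exact: W lk mkl.
    by apply: W kl _; rewrite -mkl mK.
  by have := mN (inl k); rewrite mkl (val_inj e) eqxx.
pose P (k : 'I_n) := [exists l : 'I_n, (l < k)%N && ((val d).1 (inl k) == inl l)].
move=> mkl; have [k1 Pk] : exists k1, P k1.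
  by exists k; apply/existsP; exists l; rewrite lk mkl eqxx.
case: (arg_minnP (@nat_of_ord n) Pk) => {k l lk mkl k1 Pk}k /existsP[l /andP[lk /eqP mk]] min_k.
have ml : (val d).1 (inl l) = inl k by rewrite -mk mK.
have nP (i j : 'I_n) : (i < k)%N -> (j < k)%N -> (val d).1 (inl i) != inl j.
  have nPlt (a c : 'I_n) : (a < c)%N -> (c < k)%N -> (val d).1 (inl c) != inl a.
    move=> ac ck; apply/eqP => mc; suff /min_k : P c by lia.
    by apply/existsP; exists a; rewrite ac mc eqxx.
  move=> ik jk; case: (ltngtP i j) => [ij|ji|/val_inj ->]; last exact: mN.
    by apply/eqP => e; have := nPlt i j ij jk; rewrite -e mK eqxx.
  exact: nPlt.
(* Otherwise the vertex [l + 1] lies strictly inside the cap, hence so does its partner, and they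
   form a cap with a higher lower end. *)
have lE : l = ord_prev k.
  apply/eqP; apply: contraT; rewrite -val_eqE /= => lk'.
  have jn : (l.+1 < n)%N by apply: leq_ltn_trans (ltn_ord k).
  pose j := Ordinal jn; have jk : (j < k)%N by rewrite /=; lia.
  have jNk : inl j != inl k :> vtx by rewrite sum_eqE -val_eqE /=; lia.
  have jNl : inl j != inl l :> vtx by rewrite sum_eqE -val_eqE /=; lia.
  have [|+ _] := pl (inl k) (inl j) jNk; first by rewrite mk.
  rewrite /sep mk /= [(k < _)%N]ltnNge ltnW //= ltnS leqnn /=.
  case e : ((val d).1 (inl j)) => [j'|j'] //= /esym.
  case: (ltnP k j') => //= kj'; first by lia.
  move=> _; have := nP j j' jk; rewrite e eqxx => /(_ _) h.
  have j'k : k = j' :> nat by apply/eqP; move: h; case: ltngtP => //; lia.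
  by move: jNl; rewrite -(mK (inl j)) e -(val_inj j'k) mk eqxx.
case: (boolP ((val d).2 (inl k))) => bk; last first.
  by exists k; rewrite /left_end bk -lE ml eqxx; case: eqP => // k0; lia.
exists l; have bl : (val d).2 (inl l) by rewrite -mk bm.
(* If [l > 0], the edge of the top vertex [z] must not separate the decorated cap from the top side.
   This forces the partner of [z] into the left column above [k], against [nP]. *)
rewrite /left_end; case: eqP => // /eqP l0; apply: contraT => _.
have n0 : (0 < n)%N by apply: leq_ltn_trans (ltn_ord k).
pose z := Ordinal n0.
have kz : inl k != inl z :> vtx by rewrite sum_eqE -val_eqE /=; lia.
have kmz : inl k != (val d).1 (inl z).
  by rewrite -(inv_eq mK) mk sum_eqE -val_eqE.
have [_ /(_ bk)] := pl _ _ kz kmz.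
rewrite /sep /=; have -> : (0 < k)%N by lia.
case e : ((val d).1 (inl z)) => [j|j] //=; case: ltnP => // jk _.
by have := nP z j _ jk; rewrite e eqxx => /(_ _)/negbTE <- //=; lia.
Qed.

Lemma increasing_ord_id (f : 'I_n -> 'I_n) :
  (forall i j : 'I_n, (i < j)%N -> (f i < f j)%N) -> forall i, f i = i.
Proof.
move=> f_incr.
have claim k : forall i j : 'I_n, j = (i + k)%N :> nat -> (f i + k <= f j)%N.
  elim: k => [|k IH] i j ij; first by rewrite (_ : j = i) ?addn0 //; apply: val_inj; rewrite /= ij addn0.
  have jn : (i + k < n)%N by have := ltn_ord j; lia.
  have := IH i (Ordinal jn) erefl; have := f_incr (Ordinal jn) j; rewrite /= ij; lia.
move=> i; apply: val_inj.
have n0 : (0 < n)%N by apply: leq_ltn_trans (ltn_ord i).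
have n1 : (n.-1 < n)%N by lia.
have := claim i (Ordinal n0) i erefl; have := claim (n.-1 - i)%N i (Ordinal n1).
have := ltn_ord (f (Ordinal n1)); have := ltn_ord i; rewrite /=; lia.
Qed.

(** Without left caps every strand propagates and planarity makes it horizontal. A blob is then
    possible on the top strand only, which is the case of row 0. *)
Lemma nonidentity_left_end d : d != id_diag -> exists i, left_end i d.
Proof.
move=> dN; apply/existsP; apply: contraT; rewrite negb_exists => /forallP nJ.
have [mK mN bm pl] := diagP d.
have mLR i : exists j, (val d).1 (inl i) == inr j.
  case e : ((val d).1 (inl i)) => [j|j]; last by exists j.
  by have [k Jk] := left_cap_left_end e; have := nJ k; rewrite Jk.
pose f i := xchoose (mLR i).
have mf i : (val d).1 (inl i) = inr (f i) by apply/eqP/(xchooseP (mLR i)).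
have f_id : forall i, f i = i.
  apply: increasing_ord_id => i j ij.
  have ji : inl j != inl i :> vtx by rewrite sum_eqE -val_eqE /=; lia.
  have [|+ _] := pl (inl i) (inl j) ji; first by rewrite mf.
  by rewrite /sep !mf /= ij.
have {mf} mE v : (val d).1 v = across v.
  case: v => i; first by rewrite mf f_id.
  by have := mf i; rewrite f_id /= => <-; rewrite mK.
case/eqP: dN; apply: val_inj; rewrite [LHS]surjective_pairing; congr pair.
  by apply/ffunP => v; rewrite mE ffunE.
have bL i : ~~ (val d).2 (inl i).
  apply/negP => bi; have n0 : (0 < n)%N by apply: leq_ltn_trans (ltn_ord i).
  case: (posnP i) => i0; first by have := nJ i; rewrite /left_end i0 eqxx bi.
  have iz : inl i != inl (Ordinal n0) :> vtx by rewrite sum_eqE -val_eqE /=; lia.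
  have [|_ /(_ bi)] := pl (inl (Ordinal n0)) (inl i) iz; first by rewrite mE.
  by rewrite /sep mE /= i0.
apply/ffunP => v; rewrite ffunE; apply/negbTE.
by case: v => i //; have := bL i; rewrite -bm mE.
Qed.
End Generators.

(** * Contracting the bar complex *)

Local Open Scope ring_scope.

Section BarCochains.
Variables (R : comPzRingType) (D : eqType).
Variables (mul : D -> D -> D) (wt : D -> D -> R) (aug : D -> R).

Notation cochain := (seq D -> R).

(* Cochains of all degrees are handled together as functions on words.  [act] is the action of [a]
   on the first letter, the empty word standing for the trivial module. *)
Definition act (a : D) (phi : cochain) : cochain := fun s =>
  if s is c :: z then wt a c * phi (mul a c :: z) else aug a * phi [::].

(** The bar coboundary without the augmentation of the first letter; that of the last letter enters
    through [act] on the empty word. On a right ideal killed by [aug] it is the whole coboundary. *)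
Fixpoint inner (phi : cochain) (t : seq D) : R :=
  if t is a :: s then - act a phi s - inner (fun z => phi (a :: z)) s else 0.

Definition cobd (phi : cochain) (t : seq D) : R :=
  (if t is a :: s then aug a * phi s else 0) + inner phi t.

(* Linearity, together with dependence of [T phi t] only on the values at words of length [f (size t)]. *)
Definition linop (f : nat -> nat) (T : cochain -> cochain) :=
  forall a phi psi chi t,
    (forall s, size s = f (size t) -> chi s = a * phi s + psi s) ->
    T chi t = a * T phi t + T psi t.

Lemma linop_comp f g T S : linop f T -> linop g S -> linop (g \o f) (T \o S).
Proof.
by move=> hT hS a phi psi chi t h; apply: hT => s hs; apply: hS => r hr; apply: h; rewrite hr /= hs.
Qed.

Lemma linop0 f T phi t : linop f T ->
  (forall s, size s = f (size t) -> phi s = 0) -> T phi t = 0.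
Proof.
move=> hT h; have := hT 1 phi phi phi t.
rewrite mul1r => /(_ _)/eqP; rewrite -subr_eq subrr eq_sym => hh.
by apply/eqP/hh => s hs; rewrite h // mulr0 addr0.
Qed.

Lemma linop_ext f T phi psi t : linop f T ->
  (forall s, size s = f (size t) -> phi s = psi s) -> T phi t = T psi t.
Proof.
move=> hT h; rewrite (hT 1 psi (fun _ => 0)) => [|s hs]; last by rewrite mul1r addr0 h.
by rewrite mul1r (linop0 (phi := fun=> 0) hT) // addr0.
Qed.

Lemma linopD T S f : linop f T -> linop f S -> linop f (fun phi t => T phi t - S phi t).
Proof.
move=> hT hS a phi psi chi t h.
by rewrite (hT _ _ _ _ _ h) (hS _ _ _ _ _ h); ring.
Qed.

Lemma act_lin u (c : R) : linop id (fun psi s => c * act u psi s).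
Proof. by move=> a phi psi chi [|d s] h /=; rewrite h //=; ring. Qed.

Lemma inner_lin : linop predn inner.
Proof.
move=> a phi psi chi t; elim: t phi psi chi => [|b s IH] phi psi chi h /=.
  by rewrite mulr0 addr0.
have -> : act b chi s = a * act b phi s + act b psi s.
  by case: s h {IH} => [|c z] /= h; rewrite h //=; ring.
case: s h IH => [|c s] h IH; first by rewrite /=; ring.
rewrite (IH (fun z => phi (b :: z)) (fun z => psi (b :: z))); first by ring.
by move=> z hz; apply: h; rewrite /= hz.
Qed.

Lemma cobd_lin : linop predn cobd.
Proof.
move=> a phi psi chi t h; rewrite /cobd (inner_lin h).
by case: t h => [|b s] h; rewrite ?h //; ring.
Qed.

Lemma eq_inner phi psi t : phi =1 psi -> inner phi t = inner psi t.
Proof. by move=> h; apply: (linop_ext inner_lin). Qed.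

Definition head_in (K : pred D) (t : seq D) : bool := if t is a :: _ then K a else false.
Definition restr (K : pred D) (phi : cochain) : cochain :=
  fun t => if head_in K t then phi t else 0.

Lemma restr_lin K : linop id (restr K).
Proof. by move=> a phi psi chi t h; rewrite /restr h //; case: ifP => _ //; ring. Qed.

(* Dual form of a contraction of the bar complex of the right ideal spanned by [K], whose basis
   consists of the words with first letter in [K]. *)
Definition contractible (K : pred D) := exists H : cochain -> cochain,
  [/\ linop S H,
      forall phi psi t, head_in K t -> (forall s, head_in K s -> phi s = psi s) -> H phi t = H psi t
    & forall phi t, head_in K t -> H (cobd phi) t + cobd (H phi) t = phi t].

Definition right_ideal (K : pred D) :=
  (forall a, K a -> aug a = 0) /\ (forall a b, K a -> K (mul a b)).

Lemma cobd_ideal K phi t : right_ideal K -> head_in K t -> cobd phi t = inner phi t.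
Proof. by move=> [h _]; case: t => [//|a s] /= /h; rewrite /cobd => ->; rewrite mul0r add0r. Qed.

Lemma inner_loc K phi psi t : right_ideal K -> head_in K t ->
  (forall s, head_in K s -> phi s = psi s) -> inner phi t = inner psi t.
Proof.
move=> [h0 hM]; case: t => [//|a s] /= Ka h.
rewrite (eq_inner (psi := fun z => psi (a :: z))); last by move=> z; apply: h.
by case: s => [|c s] /=; rewrite ?(h0 _ Ka) ?mul0r // h //=; apply: hM.
Qed.

Lemma cobd_loc K phi psi t : right_ideal K -> head_in K t ->
  (forall s, head_in K s -> phi s = psi s) -> cobd phi t = cobd psi t.
Proof. by move=> Kr Kt h; rewrite !(cobd_ideal _ Kr Kt) (inner_loc Kr Kt h). Qed.

Lemma contractible0 : contractible pred0.
Proof.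
exists (fun _ _ => 0); split; [by move=> *; ring | by move=> ? ? [] | by move=> phi []].
Qed.

Lemma contractible_eq K L : K =1 L -> contractible K -> contractible L.
Proof.
move=> KL [H [h1 h2 h3]]; have hKL t : head_in L t = head_in K t by case: t => //= a s; rewrite KL.
exists H; split=> // [phi psi t|phi t]; rewrite hKL; last exact: h3.
by move=> Kt h; apply: h2 => // s; rewrite -hKL; apply: h.
Qed.

Hypothesis mulA : forall a b c, mul a (mul b c) = mul (mul a b) c.
Hypothesis wtA : forall a b c, wt b c * wt a (mul b c) = wt a b * wt (mul a b) c.
Hypothesis augM : forall a b, wt a b * aug (mul a b) = aug a * aug b.

Lemma act_act a c phi s : act c (act a phi) s = wt a c * act (mul a c) phi s.
Proof.
case: s => [|d s] /=; first by rewrite !mulrA augM; ring.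
by rewrite !mulrA wtA mulA.
Qed.

Lemma innerZ c phi t : inner (fun z => c * phi z) t = c * inner phi t.
Proof.
elim: t phi => [|a s IH] phi /=; first by rewrite mulr0.
rewrite IH (_ : act a _ s = c * act a phi s); first by ring.
by case: s {IH} => [|b s] /=; ring.
Qed.

(** Left multiplication on the first letter is a chain map for [inner]; this lets the retraction by
    [c u] commute with coboundaries. *)
Lemma act_inner a phi s : act a (inner phi) s = inner (act a phi) s.
Proof.
case: s => [|c s] /=; first by rewrite mulr0.
by rewrite act_act innerZ; ring.
Qed.

Lemma inner_inner phi t : inner (inner phi) t = 0.
Proof.
elim: t phi => [//|a s IH] phi.
have -> : inner (inner phi) (a :: s) =
   - act a (inner phi) s - inner (fun z => inner phi (a :: z)) s by [].
rewrite (@inner_lin (-1) (act a phi) (fun z => - inner (fun y => phi (a :: y)) z)).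
  have -> : inner (fun z => - inner (fun y => phi (a :: y)) z) s
     = - inner (inner (fun y => phi (a :: y))) s.
    by rewrite -mulN1r -innerZ; apply: eq_inner => z; rewrite mulN1r.
  by rewrite IH act_inner; ring.
by move=> z _ /=; ring.
Qed.

Lemma cobd_inner K phi t : right_ideal K -> head_in K t -> cobd (cobd phi) t = 0.
Proof.
move=> Kr Kt; rewrite (cobd_ideal _ Kr Kt) -[RHS](inner_inner phi t).
by apply: (inner_loc Kr Kt) => s Ks; rewrite (cobd_ideal _ Kr Ks).
Qed.

(* [J] spans the right ideal generated by the idempotent [c u], so prepending [u] contracts its bar
   complex, and left multiplication by [c u] retracts [K'] onto [Q := J :&: P].  On words with first
   letter in [J] but not in [P] the contraction is corrected by the difference [G] of the contractions
   for [J] and [P], precomposed with the one for [Q]. *)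
Section Step.
Variables (K' P J : pred D) (u : D) (c : R).
Hypotheses (Pr : right_ideal P) (Jr : right_ideal J) (Ju : J u).
Hypotheses (uJ : forall a, J a -> mul u a = a) (wJ : forall a, J a -> c * wt u a = 1).
Hypotheses (K'r : right_ideal K') (K'P : subpred K' P)
  (JP : forall a, J a -> P a -> K' a) (uK : forall a, K' a -> K' (mul u a)).

Lemma contractible_step : contractible K' -> contractible P -> contractible (predU P J).
Proof.
move=> [HK [HKlin HKloc HKcon]] [HP [HPlin HPloc HPcon]].
pose Q := predI J P.
have Qr : right_ideal Q.
  split=> [a /andP[Ja _]|a b /andP[Ja Pa]]; first exact: Jr.1.
  by apply/andP; split; [apply: Jr.2|apply: Pr.2].
have QK t : head_in Q t -> head_in K' t by case: t => [//|a s] /andP[Ja Pa]; apply: JP.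
have QJ t : head_in Q t -> head_in J t by case: t => [//|a s] /andP[].
have QP t : head_in Q t -> head_in P t by case: t => [//|a s] /andP[].
pose rho psi t := c * act u psi t.
(* The sign cancels the one with which [inner] multiplies the first two letters, [u] and the head of
   [t]. *)
pose HJ (phi : cochain) : cochain := fun t => - (c * phi (u :: t)).
have HJlin : linop S HJ by move=> a phi psi chi t h; rewrite /HJ h //; ring.
have HJcon phi t : head_in J t -> HJ (cobd phi) t + cobd (HJ phi) t = phi t.
  case: t => [//|a s] /= Ja; rewrite (@cobd_ideal J) //.
  have -> : inner (HJ phi) (a :: s) = - c * inner (fun z => phi (u :: z)) (a :: s).
    by rewrite -innerZ; apply: eq_inner => z; rewrite /HJ mulNr.
  rewrite /HJ /cobd Jr.1 //.
  have -> : inner phi (u :: a :: s) = - (wt u a * phi (mul u a :: s))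
    - inner (fun z => phi (u :: z)) (a :: s) by [].
  by rewrite uJ // -[RHS]mul1r -(wJ Ja); ring.
(* [Q] lies in [K'], and left multiplication by [c u] maps [K'] into [Q] and fixes [Q], so the
   contraction of [K'] induces one of [Q]. *)
pose HQ psi := HK (rho psi).
have HQlin : linop S HQ := linop_comp HKlin (act_lin u c).
have HQloc phi psi t : head_in Q t -> (forall s, head_in Q s -> phi s = psi s) -> HQ phi t = HQ psi t.
  move=> Qt h; apply: HKloc (QK _ Qt) _ => -[//|b s] /= K'b.
  rewrite /rho /= h //=; apply/andP; split; first exact: Jr.2.
  exact/K'P/uK.
have HQcon psi t : head_in Q t -> HQ (cobd psi) t + cobd (HQ psi) t = psi t.
  move=> Qt; have K't := QK _ Qt.
  have -> : HQ (cobd psi) t = HK (cobd (rho psi)) t.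
    apply: HKloc => // -[//|b s] /= K'b.
    rewrite (@cobd_ideal K') // innerZ -act_inner /rho /= (@cobd_ideal J) //.
    exact: Jr.2.
  rewrite HKcon // /rho; case: t Qt {K't} => [//|a s] /andP[Ja _].
  by rewrite /= uJ // mulrA wJ // mul1r.
(* Both homotopies contract on [Q], so [G] anticommutes with the coboundary there. Hence on [Q] the
   difference [G phi - cobd (HQ (G phi))] equals [- HQ (G (cobd phi))], the cancellation behind
   [corr]. *)
pose G phi t := HJ phi t - HP phi t.
have Glin : linop S G by apply: linopD.
pose corr phi := cobd (restr Q (HQ (G phi))).
(* The degree shifts compose to [predn] followed by two successors, which is [S] on nonempty words
   only. *)
have corrlin a phi psi chi t : t <> [::] ->
    (forall s, size s = (size t).+1 -> chi s = a * phi s + psi s) ->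
    corr chi t = a * corr phi t + corr psi t.
  move=> tN h; apply: (linop_comp cobd_lin (linop_comp (restr_lin Q) (linop_comp HQlin Glin))).
  by case: t tN h.
exists (fun phi t => if head_in P t then HP phi t else if head_in J t then HJ phi t - corr phi t else 0).
split.
- move=> a phi psi chi t h.
  case: ifP => _; first exact: HPlin.
  case: ifP => Jt; last by ring.
  by rewrite (HJlin _ _ _ _ _ h) (corrlin _ _ _ _ _ _ h); [ring | case: t Jt {h}].
- move=> phi psi t KT h.
  have hP s : head_in P s -> phi s = psi s by move=> Ps; apply: h; case: s Ps => //= a s ->.
  have hJ s : head_in J s -> phi s = psi s by move=> Js; apply: h; case: s Js => //= a s ->; rewrite orbT.
  case: ifP => [Pt|_]; first exact: HPloc.
  case: ifP => [Jt|//].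
  congr (_ - _); first by rewrite /HJ hJ.
  apply: (cobd_loc Jr Jt) => s _; rewrite /restr; case: ifP => // Qs.
  apply: HQloc => // r Qr'; rewrite /G /HJ hJ //; congr (_ - _).
  by apply: HPloc => //; apply: QP.
move=> phi t KT.
set HK' := (X in cobd X t).
case: ifP => [Pt|PNt].
  rewrite (@cobd_loc P HK' (HP phi)) //; first exact: HPcon.
  by move=> s Ps; rewrite /HK' Ps.
have Jt : head_in J t by case: t KT PNt => //= a s; case: (P a).
rewrite Jt.
(* On [Q] the new homotopy is [HP], not [HJ - corr]; the [restr] term is the difference of the
   two. *)
have HK'E s : head_in J s -> HK' s = (HJ phi s - corr phi s) - restr Q (fun z => G phi z - corr phi z) s.
  move=> Js; rewrite /HK' Js /restr.
  have -> : head_in Q s = head_in P s by case: s Js => //= a s Ja; rewrite /Q /= Ja.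
  by case: ifP => _; rewrite /G; ring.
rewrite (cobd_loc Jr Jt HK'E).
have cobdB f g : cobd (fun s => f s - g s) t = cobd f t - cobd g t.
  rewrite (@cobd_lin (-1) g f); first by rewrite mulN1r addrC.
  by move=> s _; ring.
rewrite !cobdB (@cobd_inner J) // subr0.
rewrite -[RHS](HJcon phi t Jt); apply/eqP; rewrite -subr_eq0; apply/eqP.
suff : corr (cobd phi) t + cobd (restr Q (fun z => G phi z - corr phi z)) t = 0.
  by move=> /eqP; rewrite addr_eq0 => /eqP ->; ring.
rewrite /corr -[X in X + _]mul1r -(@cobd_lin _ _ _
  (fun s => 1 * restr Q (HQ (G (cobd phi))) s + restr Q (fun z => G phi z - corr phi z) s)) //.
apply: (linop0 cobd_lin) => s _; rewrite /restr.
case: ifP => [Qs|_]; last by rewrite mulr0 addr0.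
have -> : corr phi s = cobd (HQ (G phi)) s.
  by apply: (cobd_loc Qr Qs) => r Qr'; rewrite /restr Qr'.
rewrite -[G phi s](HQcon (G phi) s Qs) addrK -(@HQlin _ _ _
  (fun r => 1 * G (cobd phi) r + cobd (G phi) r)) //.
rewrite -[RHS](linop0 (phi := fun=> 0) (t := s) HQlin) //.
apply: HQloc => // r Qr'; rewrite mul1r /G.
have -> : cobd (fun z => HJ phi z - HP phi z) r = cobd (HJ phi) r - cobd (HP phi) r.
  rewrite (@cobd_lin (-1) (HP phi) (HJ phi)); first by rewrite mulN1r addrC.
  by move=> z _; ring.
have := HJcon phi r (QJ _ Qr'); have := HPcon phi r (QP _ Qr').
move: (HP _ r) (HJ _ r) (cobd (HP _) r) (cobd (HJ _) r) => a b a' b' <- e.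
by rewrite -[b](addrK b') e; ring.
Qed.
End Step.

Section Cover.
Variables (N : nat) (J : nat -> pred D) (u : nat -> D) (c : nat -> R).
Hypotheses (Jr : forall i, (i < N)%N -> right_ideal (J i))
  (Ju : forall i, (i < N)%N -> J i (u i))
  (uJ : forall i a, (i < N)%N -> J i a -> mul (u i) a = a)
  (wJ : forall i a, (i < N)%N -> J i a -> c i * wt (u i) a = 1)
  (JS : forall i a, (i.+1 < N)%N -> J i a -> ~~ J i.+1 a)
  (JJ : forall i j a, (i.+1 < j < N)%N -> J i a -> J i (mul (u j) a)).

Definition union_below m : pred D := fun a => [exists i : 'I_m, J i a].

Lemma union_belowP m a : reflect (exists2 i, (i < m)%N & J i a) (union_below m a).
Proof.
apply: (iffP existsP) => [[i Ji]|[i im Ji]]; first by exists i.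
by exists (Ordinal im).
Qed.

Lemma union_below_ideal m : (m <= N)%N -> right_ideal (union_below m).
Proof.
move=> mN; split=> [a /union_belowP[i im]|a b /union_belowP[i im Ji]].
  by apply: (Jr _).1; apply: leq_trans mN.
apply/union_belowP; exists i => //.
by apply: (Jr _).2 => //; apply: leq_trans mN.
Qed.

Lemma union_belowS m : predU (union_below m) (J m) =1 union_below m.+1.
Proof.
move=> a /=; apply/orP/union_belowP => [[/union_belowP[i im Ji]|Jm]|[i]].
- by exists i => //; apply: ltnW.
- by exists m.
rewrite ltnS leq_eqVlt => /orP[/eqP -> |im Ji]; first by right.
by left; apply/union_belowP; exists i.
Qed.

Lemma contractible_union m : (m <= N)%N -> contractible (union_below m).
Proof.
(* Passing from [m] to [m.+1] uses the contractions at [m] and at [m.-1], since [J m] misses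
   [J m.-1]; the induction carries both. At 0 both unions are empty. *)
suff: (m <= N)%N -> contractible (union_below m.-1) /\ contractible (union_below m).
  by move=> h /h[].
elim: m => [_|m IH mN].
  by split; apply: contractible_eq contractible0 => a; apply/esym/existsP => -[[]].
have [C1 C0] := IH (ltnW mN); split=> //.
apply: contractible_eq (union_belowS m) _.
have m1N : (m.-1 <= N)%N by apply: leq_trans (leq_pred m) (ltnW mN).
apply: (@contractible_step (union_below m.-1) (union_below m) (J m) (u m) (c m)) => //.
- exact/union_below_ideal/ltnW.
- exact: Jr.
- exact: Ju.
- by move=> a; apply: uJ.
- by move=> a; apply: wJ.
- exact: union_below_ideal m1N.
- move=> a /union_belowP[i im Ji]; apply/union_belowP; exists i => //.
  exact: leq_trans im (leq_pred m).
- move=> a Jm /union_belowP[i im Ji]; apply/union_belowP; exists i => //.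
  case: m mN im Jm {IH C1 C0 m1N} => [//|m] mN; rewrite ltnS leq_eqVlt => /orP[/eqP e|//].
  by subst i; rewrite (negPf (JS mN Ji)).
- move=> a /union_belowP[i im Ji]; apply/union_belowP; exists i => //.
  apply: JJ => //; rewrite mN andbT.
  by case: m im {mN IH C1 C0 m1N}.
Qed.
End Cover.

Variable one : D.
Hypotheses (mul1 : forall a, mul one a = a) (wt1 : forall a, wt one a = 1) (aug1 : aug one = 1).

(* The missing words start with the unit, and prepending the unit contracts them. *)
Lemma contraction K : right_ideal K -> (forall a, ~~ K a -> a = one) -> contractible K ->
  exists2 H : cochain -> cochain, linop S H &
    forall phi t, t <> [::] -> H (cobd phi) t + cobd (H phi) t = phi t.
Proof.
move=> Kr K1 [H [Hlin Hloc Hcon]].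
exists (fun phi t => if head_in K t then H phi t else phi (one :: t)) => [a phi psi chi t h|phi t tN].
  by case: ifP => _; [apply: Hlin | rewrite h].
case: ifP => Kt.
  rewrite -[RHS]Hcon //; congr (_ + _); apply: (cobd_loc Kr Kt) => s Ks.
  by rewrite Ks.
case: t tN Kt => [//|a s] _ /= /negbT /[dup] Ka /K1 e; subst a.
have act1 psi r : act one psi r = psi r.
  by case: r => [|b r] /=; rewrite ?aug1 ?mul1 ?wt1 mul1r.
(* The augmentation of the leading unit cancels against its product with the next letter. *)
have cobd1 psi r : cobd psi (one :: r) = - inner (fun z => psi (one :: z)) r.
  by rewrite /cobd aug1 mul1r /= act1 addrA subrr add0r.
rewrite !cobd1 /= act1 (eq_inner (psi := fun z => phi [:: one, one & z])); first by ring.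
by move=> z; rewrite /= (negPf Ka).
Qed.
End BarCochains.

(** * Tor and Ext of the blob algebra *)

Section Bridge.
Variables (R : comPzRingType) (n : nat) (delta gamma : R).
Notation diag := (diag n).

Definition loop_weight (a b : diag) : R := delta ^+ nloops_plain a b * gamma ^+ nloops_blob a b.

Notation coboundary := (cobd (@diag_mul n) loop_weight (@tau R n)).
Notation inner := (inner (@diag_mul n) loop_weight (@tau R n)).

Lemma innerE (x0 a : diag) s (phi : seq diag -> R) (t := a :: s) :
  inner phi t =
   \sum_(i < size s) (-1) ^+ i.+1 * (loop_weight (nth x0 t i) (nth x0 t i.+1) *
       phi (take i t ++ diag_mul (nth x0 t i) (nth x0 t i.+1) :: drop i.+2 t))
   + (-1) ^+ (size s).+1 * tau R (nth x0 t (size s)) * phi (take (size s) t).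
Proof.
rewrite {}/t; elim: s a phi => [|b s IH] a phi.
  by rewrite /= big_ord0 expr1; ring.
have -> : inner phi [:: a, b & s] =
  - (loop_weight a b * phi (diag_mul a b :: s)) - inner (fun z => phi (a :: z)) (b :: s) by [].
rewrite IH big_ord_recl /= drop0 expr1 !opprD -!addrA mulN1r; congr (_ + _).
rewrite -sumrN; congr (_ + _); last by rewrite [in RHS]exprS mulN1r !mulNr.
by apply: eq_bigr => i _; rewrite /bump /= add1n [in RHS]exprS mulN1r mulNr.
Qed.

Lemma sum_word q (w : seq diag) (phi : seq diag -> R) : size w = q ->
  \sum_(s : q.-tuple diag) (val s == w)%:R * phi s = phi w.
Proof.
move=> /eqP wq; rewrite (bigD1 (Tuple wq)) //= eqxx mul1r big1 ?addr0 // => s sw.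
case: eqP => [e|_]; last by rewrite mul0r.
by move/eqP: sw; case; apply: val_inj.
Qed.

Lemma mulcE (a b e : diag) : mulc delta gamma a b e = (e == diag_mul a b)%:R * loop_weight a b.
Proof. by rewrite /mulc compositeE; case: eqP => [_|_]; rewrite ?mul1r ?mul0r. Qed.

Lemma bd_cons q (a : diag) (s r : q.-tuple diag) (t := a :: s) :
  bd delta gamma [tuple of a :: s] r =
  tau R a * (val r == s)%:R
  + \sum_(i < q) (-1) ^+ i.+1 *
      \sum_(e : diag) mulc delta gamma (nth a t i) (nth a t i.+1) e
                          * (val r == take i t ++ e :: drop i.+2 t)%:R
  + (-1) ^+ q.+1 * tau R (nth a t q) * (val r == take q t)%:R.
Proof. by rewrite /bd; cbv zeta; rewrite theadE. Qed.

Lemma sum_bd q (t : q.+1.-tuple diag) (phi : seq diag -> R) :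
  \sum_(s : q.-tuple diag) bd delta gamma t s * phi s = coboundary phi t.
Proof.
case/tupleP: t => a s; rewrite /cobd.
have sz : size s = q := size_tuple s.
have szt : size (a :: s) = q.+1 by rewrite /= sz.
under eq_bigr => r _ do rewrite bd_cons !mulrDl.
have -> : inner phi [tuple of a :: s] = inner phi (a :: s) by [].
rewrite (innerE a) sz /= addrA.
rewrite !big_split /=; congr (_ + _ + _).
- rewrite -(sum_word phi sz) big_distrr /=; apply: eq_bigr => r _; by rewrite mulrA.
- under eq_bigr => r _ do rewrite big_distrl /=.
  rewrite exchange_big /=; apply: eq_bigr => i _.
  under eq_bigr => r _ do rewrite -mulrA.
  rewrite -big_distrr /=; congr (_ * _).
  under eq_bigr => r _ do rewrite big_distrl /=.
  rewrite exchange_big /= (bigD1 (diag_mul (nth a (a :: s) i) (nth a s i))) //=.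
  rewrite [X in _ + X]big1 => [|e /negPf ne]; last first.
    by apply: big1 => r _; rewrite mulcE ne !mul0r.
  rewrite addr0 -(sum_word (q := q)).
    rewrite big_distrr /=; apply: eq_bigr => r _.
    by rewrite mulcE eqxx mul1r mulrA.
  rewrite size_cat size_takel /= ?size_drop ?sz; first by have := ltn_ord i; lia.
  by have := ltn_ord i; lia.
rewrite -(sum_word (q := q) (w := take q (a :: s))); last by rewrite size_takel // szt.
by rewrite big_distrr /=; apply: eq_bigr => r _; rewrite mulrA.
Qed.

Definition word_indicator (w : seq diag) : seq diag -> R := fun r => (r == w)%:R.

(** The alphabet is finite, so a cochain on words of fixed length is a finite combination of
    indicators and [H] is given by a matrix. *)
Lemma linop_sum q f (H : (seq diag -> R) -> seq diag -> R) (phi : seq diag -> R) t :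
  linop f H -> f (size t) = q ->
  H phi t = \sum_(s : q.-tuple diag) phi s * H (word_indicator s) t.
Proof.
move=> Hlin tq.
have L (l : seq (q.-tuple diag)) :
    H (fun w => \sum_(s <- l) phi s * word_indicator s w) t = \sum_(s <- l) phi s * H (word_indicator s) t.
  elim: l => [|s l IH]; first by rewrite big_nil (linop0 Hlin) // => w _; rewrite big_nil.
  by rewrite big_cons -IH; apply: Hlin => w _; rewrite big_cons.
rewrite -L; apply: (linop_ext Hlin) => w wq.
rewrite -[LHS](sum_word (q := q)); last by rewrite wq.
by apply: eq_bigr => s _; rewrite mulrC /word_indicator eq_sym.
Qed.

(** The two augmentations of the single letter carry opposite signs. *)
Lemma bd0 (t : 1.-tuple diag) (s : 0.-tuple diag) : bd delta gamma t s = 0.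
Proof.
case/tupleP: t => a r; rewrite bd_cons big_ord0 addr0 (tuple0 s) (tuple0 r) /=.
by rewrite !mulr1 expr1 mulN1r subrr.
Qed.

Section Homology.
Variable H : (seq diag -> R) -> seq diag -> R.
Hypotheses (Hlin : linop S H)
  (Hcon : forall phi t, t <> [::] -> H (coboundary phi) t + coboundary (H phi) t = phi t).

Lemma tuple_neq_nil q (t : q.+1.-tuple diag) : val t <> [::].
Proof. by case/tupleP: t. Qed.

Lemma ext_vanish q (f : {ffun q.+1.-tuple diag -> R}) :
  ext_d delta gamma f = 0 -> exists g, ext_d delta gamma g = f.
Proof.
(* [f] is extended by zero to words of other lengths; [H] never sees these values, as it respects
   degree. *)
move=> f0; pose phi (w : seq diag) : R := if insub w is Some s then f s else 0.
have phiE (s : q.+1.-tuple diag) : phi s = f s by rewrite /phi valK.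
exists [ffun s : q.-tuple diag => H phi s]; apply/ffunP => t; rewrite ffunE.
under eq_bigr => s _ do rewrite ffunE.
rewrite sum_bd -phiE -[RHS]Hcon ?(linop0 Hlin) ?add0r //; last exact: tuple_neq_nil.
move=> w; rewrite size_tuple => /eqP wq; move/ffunP/(_ (Tuple wq)): f0; rewrite !ffunE => f0.
rewrite -[w]/(val (Tuple wq)) -sum_bd -[RHS]f0.
by apply: eq_bigr => s _; rewrite phiE.
Qed.

(* Transposes the contraction [H] of cochains into one of chains. *)
Lemma tor_vanish q (x : {ffun q.+1.-tuple diag -> R}) :
  tor_d delta gamma x = 0 -> exists y, tor_d delta gamma y = x.
Proof.
move=> x0.
have bdE q' (t : q'.+1.-tuple diag) s : bd delta gamma t s = coboundary (word_indicator s) t.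
  rewrite -sum_bd (bigD1 s) //= /word_indicator eqxx mulr1 big1 ?addr0 // => r rs.
  by rewrite (_ : _ == _ = false) ?mulr0 //; apply/negbTE.
exists [ffun s : q.+2.-tuple diag => \sum_(t : q.+1.-tuple diag) x t * H (word_indicator s) t].
apply/ffunP => s0; rewrite ffunE.
under eq_bigr => s _ do rewrite ffunE big_distrl /=.
rewrite exchange_big /=.
transitivity (\sum_(t : q.+1.-tuple diag) x t * (word_indicator s0 t - coboundary (H (word_indicator s0)) t)).
  apply: eq_bigr => t _.
  rewrite -(Hcon (word_indicator s0) (@tuple_neq_nil _ t)) addrK (linop_sum (q := q.+2) _ Hlin) ?size_tuple //.
  rewrite big_distrr /=; apply: eq_bigr => s _; by rewrite bdE -mulrA [X in x t * X]mulrC.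
under eq_bigr => t _ do rewrite mulrBr.
rewrite sumrB -[RHS]subr0; congr (_ - _).
  rewrite (bigD1 s0) //= /word_indicator eqxx mulr1 big1 ?addr0 // => t ts.
  by rewrite (_ : _ == _ = false) ?mulr0 //; apply/negbTE.
under eq_bigr => t _ do rewrite -sum_bd big_distrr /=.
rewrite exchange_big big1 //= => r _.
under eq_bigr => t _ do rewrite mulrA.
by rewrite -big_distrl /=; move/ffunP/(_ r): x0; rewrite !ffunE => ->; rewrite mul0r.
Qed.

End Homology.
End Bridge.

Lemma blob_contraction (R : comPzRingType) (n : nat) (delta gamma delta' : R) :
  (0 < n)%N -> delta * delta' = 1 ->
  exists2 H : (seq (diag n) -> R) -> seq (diag n) -> R, linop S H &
    forall phi t, t <> [::] ->
      H (cobd (@diag_mul n) (loop_weight delta gamma) (@tau R n) phi) t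
      + cobd (@diag_mul n) (loop_weight delta gamma) (@tau R n) (H phi) t = phi t.
Proof.
case: n => // n _ dd'.
pose J k : pred (diag n.+1) := left_end (inord k).
pose u k : diag n.+1 := gen (inord k).
(* The decorated identity is idempotent, whereas squaring a cup-cap diagram closes one plain loop,
   hence the factor [delta']. *)
pose c k : R := if k is 0 then 1 else delta'.
have tauE (d : diag n.+1) : tau R d = (d == id_diag n.+1)%:R by [].
have Jtau k d : J k d -> tau R d = 0.
  move=> Jd; rewrite tauE; case: eqP => // e.
  by have := left_end_id (inord k : 'I_n.+1); rewrite -e -/(J k d) Jd.
have J1 d : d != id_diag n.+1 -> exists2 k, (k < n.+1)%N & J k d.
  by move=> /nonidentity_left_end[i Ji]; exists (nat_of_ord i); rewrite ?ltn_ord // /J inord_val.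
have JM k a b : J k a -> J k (diag_mul a b) by apply: left_end_mulr.
have [idM id_p id_b] : [/\ forall d, diag_mul (id_diag n.+1) d = d,
     forall d, nloops_plain (id_diag n.+1) d = 0%N & forall d, nloops_blob (id_diag n.+1) d = 0%N].
  by split=> d; have [] := id_mul d.
have mA (a b d : diag n.+1) : diag_mul a (diag_mul b d) = diag_mul (diag_mul a b) d.
  by have [] := diag_mulA a b d.
have wA (a b d : diag n.+1) : loop_weight delta gamma b d * loop_weight delta gamma a (diag_mul b d) =
   loop_weight delta gamma a b * loop_weight delta gamma (diag_mul a b) d :> R.
  have [_ hp hb] := diag_mulA a b d.
  by rewrite /loop_weight mulrACA -!exprD hp hb [RHS]mulrACA -!exprD.
have w1 d : loop_weight delta gamma (id_diag n.+1) d = 1 :> R.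
  by rewrite /loop_weight id_p id_b mulr1.
(* If [a] is not the identity, it lies in some [J k] together with its products, and both sides
   vanish. *)
have tM (a b : diag n.+1) : loop_weight delta gamma a b * tau R (diag_mul a b) = tau R a * tau R b.
  case: (eqVneq a (id_diag n.+1)) => [->|/J1[k _ Jk]].
    by rewrite idM w1 [tau R (id_diag _)]tauE eqxx.
  by rewrite (Jtau _ _ Jk) (Jtau k) ?mulr0 ?mul0r //; apply: JM.
have Jr k : right_ideal (@diag_mul n.+1) (@tau R n.+1) (J k).
  by split=> [a|a b]; [apply: Jtau | apply: JM].
have C : contractible (@diag_mul n.+1) (loop_weight delta gamma) (@tau R n.+1) (union_below J n.+1).
  apply: (contractible_union (N := n.+1) mA wA tM (u := u) (c := c)) => //.
  - by move=> i _; apply: gen_left_end.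
  - by move=> i a _ Ja; have [] := gen_mul Ja.
  - move=> i a iN Ja; rewrite /loop_weight; have [_ -> ->] := gen_mul Ja.
    by rewrite inordK // /c expr0 mulr1; case: (i) => [|k]; rewrite ?mulr1 // expr1 mulrC.
  - move=> i a iN; apply: left_end_adjacent.
    by rewrite !inordK //; apply: ltnW.
  move=> i j a /andP[ij jN]; apply: left_end_gen.
  by rewrite !inordK //; apply: ltn_trans jN; apply: ltnW.
apply: (contraction idM w1 _ _ _ C).
- by rewrite tauE eqxx.
- exact: union_below_ideal.
move=> a; apply: contraNeq => /J1[k kn Jk].
by apply/union_belowP; exists k.
Qed.

Theorem theorem9p4 (R : comPzRingType) (n : nat) (delta gamma : R) :
  (0 < n)%N ->
  (exists delta', delta * delta' = 1) ->
  (exists gamma', gamma * gamma' = 1) ->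
  (* Tor_0 = coker (C_1 -> C_0) is isomorphic to k *)
  (exists phi : chain R n 0 -> R,
      (forall (a : R) (x y : chain R n 0), phi [ffun s => a * x s + y s] = a * phi x + phi y)
      /\ (forall r : R, exists x, phi x = r)
      /\ (forall x, phi x = 0 <-> exists z, tor_d delta gamma z = x))
  (* Tor_q = 0 for q > 0 *)
  /\ (forall (q : nat) (x : chain R n q.+1),
        tor_d delta gamma x = 0 -> exists y, tor_d delta gamma y = x)
  (* Ext^0 = ker (C^0 -> C^1) is isomorphic to k *)
  /\ (exists psi : R -> chain R n 0,
      (forall a r s : R, psi (a * r + s) = [ffun t => a * psi r t + psi s t])
      /\ injective psi
      /\ (forall f, ext_d delta gamma f = 0 <-> exists r, psi r = f))
  (* Ext^q = 0 for q > 0 *)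
  /\ (forall (q : nat) (f : chain R n q.+1),
        ext_d delta gamma f = 0 -> exists g, ext_d delta gamma g = f).
Proof.
move=> n0 [delta' dd'] _.
have [H Hlin Hcon] := blob_contraction gamma n0 dd'.
split; [|split; [|split]].
- exists (fun x => x [tuple]); split; [|split].
  + by move=> a x y; rewrite ffunE.
  + by move=> r; exists [ffun=> r]; rewrite ffunE.
  move=> x; split=> [x0|[z <-]].
    exists 0; apply/ffunP => s; rewrite (tuple0 s) x0 ffunE big1 // => t _.
    by rewrite bd0 mulr0.
  by rewrite ffunE big1 // => t _; rewrite bd0 mulr0.
- by move=> q x; apply: (tor_vanish Hlin Hcon).
- exists (fun r => [ffun=> r]); split; [|split].
  + by move=> a r s; apply/ffunP => t; rewrite !ffunE.
  + by move=> r s /ffunP/(_ [tuple]); rewrite !ffunE.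
  move=> f; split=> [_|[r <-]].
    by exists (f [tuple]); apply/ffunP => s; rewrite ffunE (tuple0 s).
  by apply/ffunP => t; rewrite !ffunE big1 // => s _; rewrite bd0 mul0r.
by move=> q f; apply: (ext_vanish Hlin Hcon).
Qed.
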